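(* Let $K$ be a number field such that the ray class group $\mathrm{Cl}_4(\mathcal{O}_K)$ of $K$ modulo $4\mathcal{O}_K$ is trivial, and such that some prime $\mathfrak{p}$ of $K$ above $2$ has absolute ramification index at least $3$. Let $G = C_2 \times C_2$. Then $K$ is a Hilbert-Speiser field of type $G$, but there exists a $G$-Galois extension $L$ of $K$ such that $\mathcal{O}_L$ is not locally free over the associated order $\mathcal{A}_{L/K}$.
   Context: For a finite abelian Galois extension $L/K$ of number fields with Galois group $G$, the associated order is $\mathcal{A}_{L/K} = \{ x \in K[G] : x(\mathcal{O}_L) \subseteq \mathcal{O}_L\}$. An extension is called tame if it is at most tamely ramified. For a finite abelian group $G$, a number field $K$ is a Hilbert-Speiser field of type $G$ if for every tame $G$-Galois extension $L/K$ the ring of integers $\mathcal{O}_L$ is free as an $\mathcal{O}_K[G]$-module. $\mathcal{O}_L$ is locally free over $\mathcal{A}_{L/K}$ if for every prime $\mathfrak{q}$ of $K$ the completion $\mathcal{O}_{L,\mathfrak{q}}$ is free over $\mathcal{A}_{L/K,\mathfrak{q}}$. *)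

(* Defs.v *)
From HB Require Import structures.
From mathcomp Require Import all_boot all_order all_fingroup all_solvable.
From mathcomp Require Import all_algebra all_field.
From mathcomp Require Import boolp classical_sets functions.

Set Implicit Arguments.
Unset Strict Implicit.
Unset Printing Implicit Defensive.

Import GRing.Theory.

Local Open Scope ring_scope.
Local Open Scope classical_set_scope.

Definition ringint (F : fieldType) : set F :=
  [set x | integralOver (intr : int -> F) x].

(* The additive subgroup generated by the op a m: the product I J of ideals
   when op is the multiplication, and I M for a module M when op is scaling. *)
Definition prodset (U V W : zmodType) (op : U -> V -> W)
    (I : set U) (M : set V) : set W :=
  [set y | exists n (a : 'I_n -> U) (m : 'I_n -> V),
     [/\ forall i, I (a i), forall i, M (m i) & y = \sum_i op (a i) (m i)]].

Section Ideals.
Variable F : fieldType.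
Implicit Types I J P m : set F.

Local Notation O := (@ringint F).

Definition submod I : Prop :=
  [/\ I 0, forall x y, I x -> I y -> I (x + y)
    & forall a x, O a -> I x -> I (a * x)].

Definition nonzero I : Prop := exists2 x, I x & x != 0.

Definition ideal I : Prop := submod I /\ I `<=` O.

Definition frac_ideal I : Prop :=
  [/\ submod I, nonzero I
    & exists d, [/\ O d, d != 0 & forall x, I x -> O (d * x)]].

Definition dilate (x : F) I : set F := [set x * y | y in I].

Definition principal (x : F) : set F := dilate x O.

Definition idealM I J : set F := prodset (fun x y : F => x * y) I J.

Definition idealX I (n : nat) : set F := iter n (idealM I) O.

(* The zero ideal is excluded: these are the finite primes of F. *)
Definition prime_ideal P : Prop :=
  [/\ ideal P, nonzero P, ~ P 1
    & forall x y, O x -> O y -> P (x * y) -> P x \/ P y].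

Definition coprime_to m I : Prop := exists x y, [/\ I x, m y & x + y = 1].

(* The fractional ideals A B^-1 with A, B nonzero integral ideals prime to m. *)
Definition frac_coprime_to m I : Prop :=
  frac_ideal I /\
  exists A B, [/\ ideal A /\ nonzero A, ideal B /\ nonzero B,
                  coprime_to m A, coprime_to m B & idealM I B = A].

(* x = 1 mod^* m *)
Definition ray_cong1 m (x : F) : Prop :=
  exists a b, [/\ O a /\ a != 0, O b /\ b != 0,
                  coprime_to m (principal a), coprime_to m (principal b)
                & m (a - b) /\ x = a / b].

Definition same_ray_class m I J : Prop :=
  exists2 x, ray_cong1 m x & I = dilate x J.

(* The quotient of the group of fractional ideals prime to m by the principal
   ideals (x) with x = 1 mod^* m has a single element. The modulus has no
   archimedean part, so no positivity is imposed on x. *)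
Definition ray_class_group_trivial m : Prop :=
  forall I J, frac_coprime_to m I -> frac_coprime_to m J ->
    same_ray_class m I J.

End Ideals.

Definition prime_below (K : fieldType) (L : fieldExtType K) (P : set L)
  : set K := [set x | ringint x /\ P x%:A].

Definition ideal_ext (K : fieldType) (L : fieldExtType K) (p : set K) : set L :=
  prodset (fun (x : K) (y : L) => x *: y) p (@ringint L).

Definition ram_index (K : fieldType) (L : fieldExtType K) (P : set L) (e : nat)
  : Prop :=
  let pOL : set L := ideal_ext (prime_below P) in
  pOL `<=` idealX P e /\ ~ (pOL `<=` idealX P e.+1).

Definition tame (K : fieldType) (L : fieldExtType K) : Prop :=
  forall (P : set L) (e l : nat),
    prime_ideal P -> ram_index P e -> prime l -> P l%:R -> ~~ (l %| e)%N.

(* The quotient M / M0 is a free module over A / A0, the action being induced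
   by act. All modules considered are finitely generated, so that only finite
   bases are needed. *)
Definition free_quot (R V : zmodType) (act : R -> V -> V)
    (A A0 : set R) (M M0 : set V) : Prop :=
  exists n (b : 'I_n -> V),
    [/\ forall i, M (b i),
        forall y, M y -> exists a : 'I_n -> R,
          (forall i, A (a i)) /\ M0 (y - \sum_i act (a i) (b i))
      & forall a : 'I_n -> R, (forall i, A (a i)) ->
          M0 (\sum_i act (a i) (b i)) -> forall i, A0 (a i)].

Definition free_over (R V : zmodType) (act : R -> V -> V)
    (A : set R) (M : set V) : Prop :=
  free_quot act A [set 0] M [set 0].

(* The q-adic completion lim M / q^n M of an O_K-module M is the quotient of
   the coherent sequences by the null ones. *)
Definition coherent (K : fieldType) (V : lmodType K) (q : set K) (M : set V)
  : set (nat -> V) :=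
  [set x | forall n, M (x n) /\
     prodset (fun (c : K) (v : V) => c *: v) (idealX q n) M (x n.+1 - x n)].

Definition null_seq (K : fieldType) (V : lmodType K) (q : set K) (M : set V)
  : set (nat -> V) :=
  [set x | forall n,
     prodset (fun (c : K) (v : V) => c *: v) (idealX q n) M (x n)].

Definition completion_free_over (K : fieldType) (R V : lmodType K)
    (act : R -> V -> V) (q : set K) (A : set R) (M : set V) : Prop :=
  free_quot (fun (a : nat -> R) (x : nat -> V) (n : nat) => act (a n) (x n))
    (coherent q A) (null_seq q A) (coherent q M) (null_seq q M).

Definition galois_with_group (K : fieldType) (L : splittingFieldType K)
    (gT : finGroupType) (G : {group gT}) : Prop :=
  galois 1%VS {:L}%VS /\ ('Gal({:L} / 1) \isog G)%g.

Section GroupRing.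
Variables (K : fieldType) (L : splittingFieldType K).

(* The elements \sum_s a_s s of K[Gal(L/K)], as their coefficient functions. *)
Definition group_ring : lmodType K := {ffun gal_of {:L} -> K^o}.

Definition group_ring_act (a : group_ring) (y : L) : L :=
  \sum_(s in 'Gal({:L} / 1)%g) a s *: s y.

Definition int_group_ring : set group_ring :=
  [set a : group_ring | forall s, ringint (a s : K)].

Definition assoc_order : set group_ring :=
  [set a : group_ring |
    forall y, ringint y -> ringint (group_ring_act a y)].

Definition locally_free_over_assoc_order : Prop :=
  forall q : set K, prime_ideal q ->
    completion_free_over group_ring_act q assoc_order (@ringint L).

End GroupRing.

Definition hilbert_speiser (K : fieldType) (gT : finGroupType)
    (G : {group gT}) : Prop :=
  forall L : splittingFieldType K, galois_with_group L G -> tame L ->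
    free_over (@group_ring_act K L) (@int_group_ring K L) (@ringint L).

Definition C2xC2 : {group 'Z_2 * 'Z_2} := setT_group ('Z_2 * 'Z_2)%type.

(* Main.v *)
Require Import Defs.
From HB Require Import structures.
From mathcomp Require Import all_boot all_order all_fingroup all_solvable.
From mathcomp Require Import all_algebra all_field.
From mathcomp Require Import boolp classical_sets functions.
From mathcomp Require Import zify ring.

Set Implicit Arguments.
Unset Strict Implicit.
Unset Printing Implicit Defensive.

Import GRing.Theory Num.Theory.
Import Order.TTheory.
Local Open Scope ring_scope.
Local Open Scope classical_set_scope.

(** Triviality of the ray class group says that K has class number one and that
    the units of O_K surject onto the units of O_K / 4.

    Let L / K be tame with group {1, s, t, st}. Every nontrivial eigenspace of
    the group on O_L is free of rank one, say O_K A, O_K B, O_K C. Tameness gives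
    an integer of trace 1: otherwise, the conjugations being linearly dependent
    modulo a prime P above 2, one of them would be in the inertia group of P and
    the ramification index would be even. Such an integer is
    (1 + x A + y B + z C) / 4 with x, y, z prime to 2, so that replacing A, B, C
    by unit multiples makes (1 + A + B + C) / 4 integral. It generates O_L over
    O_K[G], as its dual basis for the trace form is integral up to a factor
    congruent to 1 modulo 4.

    For the second part let p = (pi) and 2 = pi^e w with e >= 3 and w prime to p,
    and let L = K(A, B) with A^2 = 1 + pi^(2 e - 3), B^2 = pi; s negates A and t
    negates B. Then (t - 1) / pi^(e - 1) and (s - 1)(t - 1) / pi^(e + 1) are in
    the associated order and independent modulo p, but modulo p both map O_L to
    the line spanned by B. Hence a combination of them kills any candidate
    generator modulo p without being zero modulo p. *)

(** * Rings of integers *)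

(** All ideal theory used here is drawn from one fact, the finiteness of O / m: pigeonhole on powers
    of an element stands in for chain conditions, and localisation at P is expressed by multipliers
    outside P. The ray class hypothesis enters twice: class number one makes each eigenlattice free,
    and units that fill the residues prime to 4 allow the generators to be rescaled so that they
    glue to one integral element. The exponent 2 e - 3 is chosen so that (A - 1) / pi^(e - 2) is a
    root of X^2 + pi^2 w X - pi, an Eisenstein polynomial with the same constant term as X^2 - pi,
    the polynomial of B. The two roots are therefore congruent modulo pi, and their difference
    divided by pi generates the next step of a totally ramified tower. Freeness of the completion is
    used only modulo p and only through the first basis vector: an element of the associated order
    that sends this vector into p O_L must be p times an element of the order. *)

Section RingOfIntegers.
Variable F : fieldType.
Implicit Types x y z : F.
Local Notation O := (@ringint F).

Lemma ringint_nat n : O n%:R. Proof. exact: integral_nat. Qed.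
Lemma ringint0 : O 0. Proof. exact: integral0. Qed.
Lemma ringint1 : O 1. Proof. exact: integral1. Qed.
Lemma ringintN x : O x -> O (- x). Proof. exact: integral_opp. Qed.
Lemma ringintD x y : O x -> O y -> O (x + y). Proof. exact: integral_add. Qed.
Lemma ringintB x y : O x -> O y -> O (x - y). Proof. exact: integral_sub. Qed.
Lemma ringintM x y : O x -> O y -> O (x * y). Proof. exact: integral_mul. Qed.

Lemma ringintX x n : O x -> O (x ^+ n).
Proof.
move=> Ox; elim: n => [|n IH]; first by rewrite expr0; apply: ringint1.
by rewrite exprS; apply: ringintM.
Qed.

Lemma ringint_sum (I : Type) (r : seq I) (P : pred I) (f : I -> F) :
  (forall i, P i -> O (f i)) -> O (\sum_(i <- r | P i) f i).
Proof. by move=> Of; apply: big_ind => //; [apply: ringint0 | apply: ringintD]. Qed.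

Lemma ringint_int (n : int) : O n%:~R. Proof. exact: integral_id. Qed.

Lemma ringint_root p x :
  p \is monic -> root p x -> (forall i, O p`_i) -> O x.
Proof. by move=> mp px /integral_poly Op; apply: integral_root_monic Op. Qed.

Lemma ringint_quadratic x b c : O b -> O c -> x ^+ 2 + b * x + c = 0 -> O x.
Proof.
move=> Ob Oc E; apply: (@ringint_root ('X^2 + (b *: 'X + c%:P))).
- rewrite monicE lead_coefDl ?lead_coefXn // size_polyXn.
  apply: leq_ltn_trans (size_polyD _ _) _; rewrite gtn_max.
  rewrite (leq_ltn_trans (size_scale_leq _ _)) ?size_polyX //.
  by rewrite (leq_ltn_trans (size_polyC_leq1 _)).
- by rewrite /root !(hornerD, hornerZ, hornerXn, hornerX, hornerC) addrA E.
- move=> i; rewrite !coefE.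
  apply: ringintD; first exact: ringint_nat.
  apply: ringintD; first by apply: ringintM => //; apply: ringint_nat.
  by case: ifP => _ //; apply: ringint0.
Qed.

Lemma ringint_sqr x : O (x ^+ 2) -> O x.
Proof.
move=> O2; apply: (@ringint_quadratic x 0 (- x ^+ 2)) => //.
- exact: ringint0.
- exact: ringintN.
- by rewrite mul0r addr0 subrr.
Qed.

End RingOfIntegers.

#[export] Hint Resolve ringint0 ringint1 ringint_nat ringintM ringintD ringintB
  ringintN ringintX : core.

(** * Ideals in rings of integers with finite quotients *)

(* O / m is finite: phi takes finitely many values, and equal values imply
   congruence modulo m. *)
Definition finite_quotients (F : fieldType) : Prop :=
  forall m : nat, (0 < m)%N -> m%:R != 0 :> F /\
    exists n (phi : F -> 'I_n), forall x y : F, ringint x -> ringint y ->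
      phi x = phi y -> ringint ((x - y) / m%:R).

Section Dedekind.
Variable F : fieldType.
Hypothesis finF : finite_quotients F.
Implicit Types (x y z c : F) (I J P : set F).
Local Notation O := (@ringint F).
Local Open Scope classical_set_scope.

(** Once the powers of X are divided out of an integral equation for x, its constant term is a
    nonzero integer and x times an element of O. *)
Lemma ringint_dvd_nat x : O x -> x != 0 ->
  exists2 m : nat, (0 < m)%N & O (m%:R / x).
Proof.
move=> Ox nzx; have [p mp px] := Ox.
have {p mp px} [p p0 px] : exists2 p : {poly int}, p`_0 != 0 &
     root (map_poly (intr : int -> F) p) x.
  have nzp : p != 0 by apply: monic_neq0.
  have [k [q nq E]] := multiplicity_XsubC p 0.
  exists q; first by move: nq; rewrite nzp /= /root horner_coef0.
  move: px; rewrite E rmorphM rmorphXn rmorphB /= map_polyX map_polyC /= rootM.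
  rewrite /root !hornerE mulr0z subr0 expf_eq0 (negPf nzx) andbF orbF //.
have E : (p`_0)%:~R = - x * (\sum_(i < (size p).-1) (p`_i.+1)%:~R * x ^+ i).
  have nzp : size p != 0%N by rewrite size_poly_eq0; apply: contraNneq p0 => ->; rewrite coef0.
  move: px; rewrite /root (horner_coef_wide _ (size_poly _ _)) -/(map_poly _ _).
  rewrite -(prednK (n := size p)) ?lt0n // big_ord_recl expr0 mulr1 coef_map /=.
  rewrite addr_eq0 => /eqP ->; rewrite mulNr mulr_sumr; congr (- _).
  by apply: eq_bigr => i _; rewrite coef_map /= /bump /= exprS mulrCA.
have O1 : O ((p`_0)%:~R / x).
  rewrite E mulNr mulrC mulrN mulrA mulVf // mul1r; apply: ringintN.
  by apply: ringint_sum => i _; apply: ringintM; [apply: ringint_int|apply: ringintX].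
exists (absz p`_0); first by rewrite absz_gt0.
move: O1; case: (p`_0) => n; first by rewrite -pmulrn.
by rewrite NegzE mulrNz -pmulrn mulNr => /ringintN; rewrite opprK.
Qed.

Lemma finite_residues c : O c -> c != 0 ->
  exists n (phi : F -> 'I_n), forall x y : F, O x -> O y ->
      phi x = phi y -> O ((x - y) / c).
Proof.
move=> Oc nzc; have [m m0 Om] := ringint_dvd_nat Oc nzc.
have [nzm [n [phi H]]] := finF m0.
exists n, phi => x y Ox Oy /(H _ _ Ox Oy) H1.
by have -> : (x - y) / c = (x - y) / m%:R * (m%:R / c); [field; apply/andP | apply: ringintM].
Qed.

(** Applied mostly to the powers of an element, this replaces Noetherian arguments below. *)
Lemma pigeonhole c (u : nat -> F) : O c -> c != 0 -> (forall i, O (u i)) ->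
  exists i j, (i < j)%N /\ O ((u i - u j) / c).
Proof.
move=> Oc nzc Ou; have [n [phi H]] := finite_residues Oc nzc.
have : ~~ injectiveb (fun i : 'I_n.+1 => phi (u i)).
  apply/negP=> /injectiveP inj.
  by have := leq_card _ inj; rewrite !card_ord ltnn.
move/injectivePn=> [i [j nij E]].
wlog lij : i j nij E / (i < j)%N.
  move=> W; case: (ltngtP i j) => L; first exact: (W i j).
    by apply: (W j i); rewrite // eq_sym.
  by rewrite -val_eqE /= L eqxx in nij.
by exists i, j; split => //; apply: H.
Qed.

(** Two of the elements c z^n agree modulo c, so z^i - z^j is integral for some i < j and serves as
    the constant term of a monic equation for z. *)
Lemma almost_integral c z : c != 0 -> (forall n, O (c * z ^+ n)) -> O z.
Proof.
move=> nzc H; have Oc : O c by have := H 0%N; rewrite expr0 mulr1.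
have [i [j [lij Oij]]] := pigeonhole Oc nzc H.
have {}Oij : O (z ^+ i - z ^+ j).
  by move: Oij; congr O; field.
apply: (@ringint_root _ ('X^j - 'X^i + (z ^+ i - z ^+ j)%:P)).
- have sz : (size ('X^i : {poly F}) < size ('X^j : {poly F}))%N by rewrite !size_polyXn.
  rewrite monicE -addrA lead_coefDl ?lead_coefXn //.
  apply: leq_ltn_trans (size_polyD _ _) _; rewrite size_polyN gtn_max sz.
  apply: leq_ltn_trans (size_polyC_leq1 _) _; rewrite size_polyXn.
  by case: j lij {Oij sz}.
- by rewrite /root !(hornerD, hornerN, hornerXn, hornerC) -(opprB (z ^+ j)) addrN.
- move=> k; rewrite !coefE; apply: ringintD; first by apply: ringintB.
  by case: ifP.
Qed.

(** * Maximality and inverses of prime ideals *)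

Section Prime.
Variable P : set F.
Hypothesis primeP : prime_ideal P.

Lemma prime_int x : P x -> O x.
Proof. by have [[_ PO] _ _ _] := primeP; apply: PO. Qed.
Lemma prime0 : P 0. Proof. by have [[[]]] := primeP. Qed.
Lemma primeD x y : P x -> P y -> P (x + y).
Proof. by have [[[_ H _] _] _ _ _] := primeP; apply: H. Qed.
Lemma primeMl x y : O x -> P y -> P (x * y).
Proof. by have [[[_ _ H] _] _ _ _] := primeP; apply: H. Qed.
Lemma primeMr x y : P x -> O y -> P (x * y).
Proof. by rewrite mulrC => Px Oy; apply: primeMl. Qed.
Lemma primeN x : P x -> P (- x).
Proof. by move=> Px; rewrite -mulN1r; apply: primeMl; auto. Qed.
Lemma primeB x y : P x -> P y -> P (x - y).
Proof. by move=> Px Py; apply: primeD => //; apply: primeN. Qed.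
Lemma prime_n1 : ~ P 1. Proof. by have [] := primeP. Qed.
Lemma primeM_or x y : O x -> O y -> P (x * y) -> P x \/ P y.
Proof. by have [_ _ _] := primeP; apply. Qed.
Lemma primeM_not x y : O x -> O y -> ~ P x -> ~ P y -> ~ P (x * y).
Proof. by move=> Ox Oy nx ny /primeM_or[]. Qed.
Lemma prime_X x n : O x -> P (x ^+ n) -> P x.
Proof.
move=> Ox; elim: n => [|n IH]; first by rewrite expr0 => /prime_n1.
by rewrite exprS => /primeM_or[]; auto.
Qed.
Lemma prime_not0 x : ~ P x -> x != 0.
Proof. by move=> nP; apply/eqP => x0; apply: nP; rewrite x0; apply: prime0. Qed.

(** Two powers of x agree modulo an element of P, so x^i (1 - x^(j - i)) lies in P and x^(j - i - 1)
    inverts x. *)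
Lemma prime_maximal x : O x -> ~ P x -> exists2 u, O u & P (1 - u * x).
Proof.
move=> Ox nPx; have [_ [c Pc nzc] _ _] := primeP.
have [i [j [lij Oij]]] := pigeonhole (prime_int Pc) nzc (fun n => ringintX n Ox).
exists (x ^+ (j - i).-1); first exact: ringintX.
rewrite -exprSr prednK ?subn_gt0 //.
have : P (x ^+ i * (1 - x ^+ (j - i))).
  rewrite mulrBr mulr1 -exprD subnKC ?(ltnW lij) //.
  by rewrite -(divfK nzc (_ - _)); apply: primeMl.
by case/primeM_or => //; [auto|auto| move/(prime_X Ox)].
Qed.

(** Here c divides r^i (1 - r^(j - i)) for some i < j, and the second factor is outside P because r
    is in P. *)
Lemma prime_locally_nilpotent c r : O c -> c != 0 -> P r ->
  exists k s, [/\ O s, ~ P s & O (s * r ^+ k / c)].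
Proof.
move=> Oc nzc Pr; have Or := prime_int Pr.
have [i [j [lij Oij]]] := pigeonhole Oc nzc (fun n => ringintX n Or).
exists i, (1 - r ^+ (j - i)); split; first by auto.
  move=> P1; apply: prime_n1; rewrite -(subrK (r ^+ (j - i)) 1).
  apply: primeD => //; rewrite -(prednK (n := (j - i))) ?subn_gt0 // exprS.
  by apply: primeMr; auto.
by rewrite [_ * r ^+ i]mulrBl mul1r -exprD addnC subnKC ?(ltnW lij).
Qed.

(* P is an associated prime of O / c: starting from y = 1, multiply by the
   residues of P modulo c as long as y stays outside c O localised at P. *)
Lemma prime_annihilator c : P c -> c != 0 ->
  exists y, [/\ O y, ~ O (y / c) & forall r, P r -> O (r * y / c)].
Proof.
move=> Pc nzc; have Oc := prime_int Pc.
have [n [phi H]] := finite_residues Oc nzc.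
(* [inR y] says that c divides y in the localisation at P. *)
pose inR y := exists s, [/\ O s, ~ P s & O (s * y / c)].
have inR_mul a y : O a -> inR y -> inR (a * y).
  move=> Oa [s [Os ns Osy]]; exists s; split => //.
  by rewrite mulrCA -mulrA; apply: ringintM.
have [y [Oy ny Hy]] : exists y, [/\ O y, ~ inR y &
    forall i : 'I_n, i \in enum 'I_n -> forall r, P r -> phi r = i -> inR (r * y)].
  elim: (enum 'I_n) => [|i e [y [Oy ny Hy]]].
    exists 1; split => //; rewrite /inR => -[s [Os ns]]; rewrite mulr1 => Osc.
    by apply: ns; rewrite -(divfK nzc s); apply: primeMl.
  case: (pselect (exists2 r, P r & phi r = i)) => [[r Pr ri]|nr]; last first.
    exists y; split => // k; rewrite inE => /orP[/eqP-> r Pr Er|]; last exact: Hy.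
    by case: nr; exists r.
  have Or := prime_int Pr.
  have [k [s [Os ns Osr]]] := prime_locally_nilpotent Oc nzc Pr.
  have ex : exists k, `[< inR (r ^+ k * y) >].
    exists k; apply/asboolP; exists s; split => //.
    by rewrite mulrA mulrAC; apply: ringintM.
  case: (ex_minnP ex) => -[|m] /asboolP inm minm; first by case: ny; rewrite -[y]mul1r.
  exists (r ^+ m * y); split; first by auto.
    by move=> /asboolP/minm; rewrite ltnn.
  move=> k'; rewrite inE => /orP[/eqP-> r' Pr' Er'|ke r' Pr' Er']; last first.
    by rewrite mulrCA; apply: inR_mul; [auto | apply: Hy ke _ Pr' Er'].
  have Or' := prime_int Pr'.
  have [s' [Os' ns' Os'r]] : inR (r * (r ^+ m * y)) by rewrite mulrA -exprS.
  exists s'; split => //.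
  have -> : s' * (r' * (r ^+ m * y)) / c = (r' - r) / c * (s' * r ^+ m * y) + s' * (r * (r ^+ m * y)) / c.
    by field.
  apply: ringintD => //; apply: ringintM; last by auto.
  by apply: H; rewrite ?ri.
(* Only finitely many residues r modulo c matter, so the product of their multipliers clears all
   denominators at once. *)
have [s [Os ns Hs]] : exists s, [/\ O s, ~ P s & forall i, i \in enum 'I_n -> forall r, P r -> phi r = i -> O (s * (r * y) / c)].
  elim: (enum 'I_n) Hy => [|i e IH] Hy; first by exists 1; split => //; apply: prime_n1.
  have [|s [Os ns Hs]] := IH; first by move=> k ke; apply: Hy; rewrite inE ke orbT.
  case: (pselect (exists2 r, P r & phi r = i)) => [[r Pr ri]|nr]; last first.
    exists s; split => // k; rewrite inE => /orP[/eqP-> r Pr Er|]; last exact: Hs.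
    by case: nr; exists r.
  have [|s' [Os' ns' Hs']] := Hy i _ r Pr ri; first by rewrite inE eqxx.
  exists (s * s'); split; [by auto | exact: primeM_not |].
  move=> k; rewrite inE => /orP[/eqP-> r' Pr' Er'|ke r' Pr' Er']; last first.
    have -> : s * s' * (r' * y) / c = s' * (s * (r' * y) / c) by ring.
    by apply: ringintM => //; apply: Hs ke _ Pr' Er'.
  have -> : s * s' * (r' * y) / c = s * ((r' - r) / c * (s' * y) + s' * (r * y) / c).
    by field.
  apply: ringintM => //; apply: ringintD => //; apply: ringintM; last by auto.
  by apply: H; rewrite ?ri //; apply: prime_int.
exists (s * y); split; [by auto | by move=> Osy; apply: ny; exists s |].
by move=> r Pr; rewrite mulrCA; apply: (Hs (phi r)); rewrite ?mem_enum.
Qed.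

(** Take z = y / c with y from [prime_annihilator]. If z P stayed inside P, all c z^n would be in P
    and z would be integral. *)
Lemma prime_inverse :
  exists z, [/\ forall x, P x -> O (z * x), exists2 x, P x & ~ P (z * x) & ~ O z].
Proof.
have [_ [c Pc nzc] _ _] := primeP.
have [y [Oy ny Hy]] := prime_annihilator Pc nzc.
exists (y / c); split => //.
  by move=> x Px; rewrite mulrC mulrA; apply: Hy.
apply: contrapT => nex; apply: ny.
apply: (almost_integral nzc) => n; apply: prime_int.
elim: n => [|n IH]; first by rewrite expr0 mulr1.
rewrite exprSr mulrA mulrC; apply: contrapT => nP; apply: nex.
by exists (c * (y / c) ^+ n).
Qed.

(** With z from [prime_inverse], some power of z makes I non-integral, since z is not almost
    integral. The power just before the first such one works: if it moved I into P, one more factor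
    z would still be harmless. *)
Lemma ideal_prime_scale I : ideal I -> nonzero I ->
  exists z, (forall x, I x -> O (z * x)) /\ exists2 x, I x & ~ P (z * x).
Proof.
move=> [_ IO] [c Ic nzc]; have [z [zP _ nz]] := prime_inverse.
have [n /asboolPn nn] : exists n, ~~ `[< forall x, I x -> O (z ^+ n * x) >].
  apply: contrapT => H; apply: nz; apply: (almost_integral nzc) => n.
  have /asboolP : `[< forall x, I x -> O (z ^+ n * x) >].
    by apply: contrapT => /negP nn; apply: H; exists n.
  by rewrite mulrC; apply.
have ex : exists n, ~~ `[< forall x, I x -> O (z ^+ n * x) >] by exists n; apply/asboolPn.
case: (ex_minnP ex) => -[|m] /asboolPn nm minm.
  by case: nm => x Ix; rewrite expr0 mul1r; apply: IO.
exists (z ^+ m); split.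
  by apply/asboolP; apply: contrapT => /negP /minm; rewrite ltnn.
apply: contrapT => nex; apply: nm => x Ix; rewrite exprS -mulrA.
by apply: zP; apply: contrapT => nP; apply: nex; exists x.
Qed.

End Prime.

(** A finite stand-in for J / c: among ideals containing c it determines J, so such ideals can be
    compared by cardinality. *)
Definition colors n (phi : F -> 'I_n) J : {set 'I_n} :=
  [set i | `[< exists2 x, J x & phi x = i >]].

Lemma colorsP n (phi : F -> 'I_n) J i :
  reflect (exists2 x, J x & phi x = i) (i \in colors phi J).
Proof. by rewrite inE; apply: asboolP. Qed.

Lemma colors_sub n (phi : F -> 'I_n) c J J' :
    (forall x y, O x -> O y -> phi x = phi y -> O ((x - y) / c)) ->
    c != 0 -> ideal J -> ideal J' -> J c ->
  colors phi J' \subset colors phi J -> J' `<=` J.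
Proof.
move=> H nzc [[_ JD JM] JO] [_ J'O] Jc /fintype.subsetP sub x J'x.
have /sub : phi x \in colors phi J' by apply/colorsP; exists x.
move=> /colorsP [y Jy E].
rewrite -(subrK y x); apply: JD => //; rewrite -(divfK nzc (x - y)).
by apply: JM => //; apply: H; auto.
Qed.

(** If J is not prime, with x y in J and x, y outside, then J + x O is larger and still proper, as
    otherwise y would be in J. The number of colors bounds how often J can grow. *)
Lemma ideal_sub_prime J c : ideal J -> J c -> c != 0 -> ~ J 1 ->
  exists2 P, prime_ideal P & J `<=` P.
Proof.
move=> idJ Jc nzc nJ1; have Oc : O c by case: idJ => _; apply.
have [n [phi H]] := finite_residues Oc nzc.
have [k] := ubnP (n - #|colors phi J|)%N.
elim: k J idJ Jc nJ1 => // k IH J idJ Jc nJ1 lk.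
case: (pselect (prime_ideal J)) => [pJ|npJ]; first by exists J.
have [[J0 JD JM] JO] := idJ.
have [x [y [Ox Oy Jxy nx ny]]] : exists x y, [/\ O x, O y, J (x * y), ~ J x & ~ J y].
  apply: contrapT => nex; apply: npJ; split => //; first by exists c.
  move=> x y Ox Oy Jxy; apply: contrapT => /not_orP[nx ny].
  by apply: nex; exists x, y.
pose J' := [set u | exists j a, [/\ J j, O a & u = j + a * x]] : set F.
have sub : J `<=` J' by move=> u Ju; exists u, 0; split; rewrite ?mul0r ?addr0.
have idJ' : ideal J'.
  split; [split|].
  - exact: sub.
  - move=> _ _ [j [a [Jj Oa ->]]] [j' [a' [Jj' Oa' ->]]].
    by exists (j + j'), (a + a'); split; [auto|auto|ring].
  - move=> b _ Ob [j [a [Jj Oa ->]]]; exists (b * j), (b * a); split; [auto|auto|ring].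
  - by move=> _ [j [a [Jj Oa ->]]]; auto.
have nJ'1 : ~ J' 1.
  move=> [j [a [Jj Oa E]]]; apply: ny; rewrite -[y]mul1r E.
  have -> : (j + a * x) * y = y * j + a * (x * y) by ring.
  by auto.
have J'x : J' x by exists 0, 1; split; rewrite ?mul1r ?add0r.
have prop : (#|colors phi J| < #|colors phi J'|)%N.
  apply: proper_card; apply/properP; split.
    apply/fintype.subsetP => i /colorsP [u Ju E].
    by apply/colorsP; exists u => //; apply: sub.
  apply: contrapT => nex; apply: nx; apply: (colors_sub H nzc idJ idJ' Jc) J'x.
  by apply/fintype.subsetP => i iJ'; apply: contrapT => /negP niJ; apply: nex; exists i.
have [|P pP J'P] := IH J' idJ' (sub _ Jc) nJ'1.
  have := max_card (mem (colors phi J')); rewrite card_ord => le.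
  rewrite -ltnS; apply: leq_trans lk.
  by rewrite ltnS ltn_sub2l // (leq_trans prop).
by exists P => // u /sub /J'P.
Qed.

(** A prime containing c is determined by its colors. The list has one entry per set of colors,
    filled with [P0] where no prime matches. *)
Lemma primes_above_finite c : O c -> c != 0 ->
  exists n (ps : 'I_n -> set F), (forall i, prime_ideal (ps i)) /\
    forall P, prime_ideal P -> P c -> exists i, P = ps i.
Proof.
move=> Oc nzc; have [n [phi H]] := finite_residues Oc nzc.
case: (pselect (exists2 P, prime_ideal P & P c)) => [[P0 pP0 P0c]|none]; last first.
  by exists 0%N, (fun=> set0); split => [[]|P pP Pc] //; case: none; exists P.
pose f (A : {set 'I_n}) : set F :=
  xget P0 [set P | [/\ prime_ideal P, P c & colors phi P = A]].
exists #|{set 'I_n}|, (fun i => f (enum_val i)).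
have fP A : prime_ideal (f A).
  rewrite /f; case: xgetP => [P -> []|] //.
split => // P pP Pc; exists (enum_rank (colors phi P)); rewrite enum_rankK.
rewrite /f; case: xgetP => [Q _ [pQ Qc E]|/(_ P)]; last by case.
have [iP _ _ _] := pP; have [iQ _ _ _] := pQ.
by apply/seteqP; split; apply: (colors_sub H nzc) => //; rewrite E.
Qed.

Lemma prime_sub_eq P Q : prime_ideal P -> prime_ideal Q -> P `<=` Q -> P = Q.
Proof.
move=> pP pQ PQ; apply/seteqP; split => // x Qx; apply: contrapT => nPx.
have Ox := prime_int pQ Qx; have [u Ou P1] := prime_maximal pP Ox nPx.
apply: (prime_n1 pQ); rewrite -(subrK (u * x) 1).
by apply: (primeD pQ); [apply: PQ | apply: (primeMl pQ)].
Qed.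

(** Prime avoidance by induction: if y I falls into the new prime P, add r z, where z I is integral
    and not inside P, and r is in all the earlier primes but not in P. *)
Lemma ideal_scale_avoiding I (ps : seq (set F)) : ideal I -> nonzero I ->
    (forall P, List.In P ps -> prime_ideal P) ->
  exists y, (forall x, I x -> O (y * x)) /\
    forall P, List.In P ps -> exists2 x, I x & ~ P (y * x).
Proof.
move=> idI nzI; have [_ IO] := idI; elim: ps => [|P ps IH] pps.
  by exists 1; split => // x Ix; rewrite mul1r; apply: IO.
have [|y [yI yps]] := IH; first by move=> Q Qps; apply: pps; right.
have pP : prime_ideal P by apply: pps; left.
case: (pselect (exists2 x, I x & ~ P (y * x))) => [ex|nex].
  by exists y; split => // Q [<-|/yps].
have {nex} yIP x : I x -> P (y * x).
  by move=> Ix; apply: contrapT => nP; apply: nex; exists x.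
have [z [zI [x0 Ix0 nPx0]]] := ideal_prime_scale pP idI nzI.
(* No earlier Q equals P, since y I lies in P but not in Q. Hence each Q has an element outside P,
   and r is their product. *)
have [r [Or nPr rps]] : exists r, [/\ O r, ~ P r & forall Q, List.In Q ps -> Q r].
  elim: ps pps yps {IH} => [|Q ps IH] pps yps.
    by exists 1; split => //; apply: prime_n1.
  have [||r [Or nPr rps]] := IH.
  - by move=> Q' [<-|Q'ps]; apply: pps; [left|right; right].
  - by move=> Q' Q'ps; apply: yps; right.
  have pQ : prime_ideal Q by apply: pps; right; left.
  have [t Qt nPt] : exists2 t, Q t & ~ P t.
    apply: contrapT => nex; have QP : Q = P.
      apply: prime_sub_eq => // t Qt; apply: contrapT => nPt.
      by apply: nex; exists t.
    by have [|x Ix] := yps Q; [left | rewrite QP; case; apply: yIP].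
  have Ot := prime_int pQ Qt.
  exists (t * r); split; [by auto | exact: primeM_not |].
  move=> Q' [<-|Q'ps]; first exact: (primeMr pQ).
  by apply: primeMl; [apply: pps; right; right | auto | apply: rps].
exists (y + r * z); split.
  by move=> x Ix; rewrite mulrDl -mulrA; auto.
move=> Q [<-|Qps].
  exists x0 => //; rewrite mulrDl => PE.
  have /(primeM_or pP) [] : P (r * (z * x0)) ; auto.
  by rewrite -[_ * _](addKr (y * x0)) addrC mulrA; apply: primeB; auto.
have [x Ix nQx] := yps Q Qps; exists x => //; rewrite mulrDl => QE; apply: nQx.
have pQ : prime_ideal Q by apply: pps; right.
rewrite -[y * x](addrK (r * z * x)); apply: primeB => //.
by rewrite -mulrA; apply: primeMr => //; [apply: rps | auto].
Qed.

(** The ideal y I + c O lies in no prime, since the finitely many primes containing c were avoided.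
    This is the fact that every ideal class has a member prime to c. *)
Lemma ideal_scale_coprime I c : ideal I -> nonzero I -> O c -> c != 0 ->
  exists y, (forall x, I x -> O (y * x)) /\ exists2 x, I x & exists2 t, O t & y * x + c * t = 1.
Proof.
move=> idI nzI Oc nzc; have [[I0 ID IM] IO] := idI.
have [n [ps [pps psP]]] := primes_above_finite Oc nzc.
have [|y [yI yps]] := @ideal_scale_avoiding I (map ps (enum 'I_n)) idI nzI.
  by elim: (enum _) => //= i e IH P [<-|/IH].
exists y; split => //.
pose J := [set u | exists x t, [/\ I x, O t & u = y * x + c * t]] : set F.
have idJ : ideal J.
  split; [split|].
  - by exists 0, 0; split => //; ring.
  - move=> _ _ [j [a [Jj Oa ->]]] [j' [a' [Jj' Oa' ->]]].
    by exists (j + j'), (a + a'); split; [auto|auto|ring].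
  - move=> b _ Ob [j [a [Jj Oa ->]]]; exists (b * j), (b * a); split; [auto|auto|ring].
  - by move=> _ [j [a [Jj Oa ->]]]; auto.
case: (pselect (J 1)) => [[x [t [Ix Ot E]]]|nJ1].
  by exists x => //; exists t.
have Jc : J c by exists 0, 1; split => //; ring.
have [P pP JP] := ideal_sub_prime idJ Jc nzc nJ1.
have [i Pi] := psP P pP (JP _ Jc).
have inP : List.In P (map ps (enum 'I_n)).
  rewrite Pi; have : i \in enum 'I_n by rewrite mem_enum.
  elim: (enum _) => //= k e IH; rewrite inE => /orP[/eqP->|/IH]; by [left|right].
have [x Ix []] := yps P inP; apply: JP; exists x, 0; split => //; ring.
Qed.

End Dedekind.

(** * Finiteness of residue rings of number fields *)

Section NumberField.
Variable F : fieldExtType rat.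
Implicit Types x y : F.
Local Notation O := (@ringint F).

Lemma numfield_intr_eq0 (n : int) : (n%:~R == 0 :> F) = (n == 0).
Proof.
have -> : (n%:~R : F) = (n%:~R)%:A by rewrite scaler_int.
by rewrite scaler_eq0 oner_eq0 orbF intr_eq0.
Qed.

Lemma numfield_nat_neq0 (n : nat) : (0 < n)%N -> n%:R != 0 :> F.
Proof. by move=> n0; have := numfield_intr_eq0 n; rewrite -pmulrn => ->; case: n n0. Qed.

Lemma int_dependence n (b : 'I_n -> F) : (\dim {:F} < n)%N ->
  exists2 c : 'I_n -> int, (exists i, c i != 0) & \sum_i (c i)%:~R * b i = 0.
Proof.
move=> ln; pose X := [tuple b i | i < n].
have : ~~ free X.
  apply/negP => /eqP fX; move: ln.
  by rewrite -(size_tuple X) -fX ltnNge dimvS // subvf.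
move/freeP => nf.
have [k sk [i nki]] : exists2 k : 'I_n -> rat, \sum_(i < n) k i *: X`_i = 0 & exists i, k i != 0.
  apply: contrapT => nex; apply: nf => k sk i; apply: contrapT => nki.
  by apply: nex; exists k => //; exists i; apply/eqP.
pose D : int := \prod_i denq (k i).
have nzD : D != 0 by apply/prodf_neq0 => j _; rewrite denq_neq0.
pose c j : int := numq (k j) * \prod_(h | h != j) denq (k h).
have cE j : (c j)%:~R = k j * D%:~R :> rat.
  rewrite /c [in RHS]/D [in RHS](bigD1 j) //= !intrM mulrA; congr (_ * _).
  by rewrite -{2}[k j]divq_num_den divfK // intr_eq0 denq_neq0.
exists c.
  exists i; rewrite -(intr_eq0 rat) cE mulf_neq0 // intr_eq0 //.
have E j : (c j)%:~R * b j = D%:~R *: (k j *: X`_j).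
  by rewrite scalerA [D%:~R * _]mulrC -cE nth_mktuple scaler_int mulrzl.
under eq_bigr do rewrite E.
by rewrite -scaler_sumr sk scaler0.
Qed.

(** The leading coefficient of an equation of x over the integers clears its denominator. *)
Lemma numfield_scale_ringint x : exists2 m : nat, (0 < m)%N & O (m%:R * x).
Proof.
pose d := \dim {:F}.
have [c [i nci] sc] := @int_dependence d.+1 (fun i => x ^+ i) (ltnSn _).
pose q : {poly int} := \poly_(j < d.+1) c (inord j).
have nzq : q != 0.
  apply: contraNneq nci => q0; have := congr1 (fun p : {poly int} => p`_i) q0.
  by rewrite coef_poly ltn_ord inord_val coef0 => ->.
have qx : \sum_(j < size q) (q`_j)%:~R * x ^+ j = 0.
  have := @horner_coef_wide F d.+1 (map_poly intr q) x _.
  rewrite (leq_trans (size_poly _ _)) ?size_poly // => /(_ isT) E.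
  have := @horner_coef_wide F (size q) (map_poly intr q) x (size_poly _ _).
  rewrite E => E2.
  have -> : \sum_(j < size q) (q`_j)%:~R * x ^+ j = \sum_(i < d.+1) (map_poly intr q)`_i * x ^+ i.
    by rewrite E2; apply: eq_bigr => j _; rewrite coef_map.
  rewrite -[RHS]sc; apply: eq_bigr => j _; rewrite coef_map coef_poly ltn_ord.
  by rewrite inord_val.
pose n := (size q).-1; have szq : size q = n.+1 by rewrite /n prednK // lt0n size_poly_eq0.
pose l := lead_coef q; have nzl : l != 0 by rewrite lead_coef_eq0.
have Ol : O (l%:~R * x).
  case: (posnP n) => [n0|n0].
    move: qx; rewrite szq n0 big_ord1 expr0 mulr1 => /eqP; rewrite numfield_intr_eq0.
    have -> : q`_(ord0 : 'I_1) = l by rewrite /l lead_coefE -/n n0.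
    by rewrite (negPf nzl).
  (* This is l^(n - 1) q(X / l). *)
  apply: (@ringint_root _ ('X^n + \poly_(j < n) (q`_j * l ^+ (n - j).-1)%:~R)).
  - rewrite monicE lead_coefDl ?lead_coefXn // size_polyXn ltnS.
    exact: size_poly.
  - rewrite /root hornerD hornerXn horner_poly.
    have -> : (l%:~R * x) ^+ n + \sum_(j < n) (q`_j * l ^+ (n - j).-1)%:~R * (l%:~R * x) ^+ j
       = l%:~R ^+ n.-1 * \sum_(j < size q) (q`_j)%:~R * x ^+ j.
      rewrite szq big_ord_recr /= mulrDr mulr_sumr addrC; congr (_ + _).
        apply: eq_bigr => j _; rewrite exprMn intrM rmorphXn /=.
        have -> : n.-1 = ((n - j).-1 + j)%N.
          by have := ltn_ord j; lia.
        rewrite exprD [(q`_j)%:~R * _]mulrC -!mulrA; congr (_ * _).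
        by rewrite mulrCA.
      rewrite -[q`_n]/(lead_coef q) -/l mulrA -exprSr prednK // exprMn //.
    by rewrite qx mulr0.
  - move=> j; rewrite coefD coefXn coef_poly; apply: ringintD; first exact: ringint_nat.
    by case: ifP => _; [apply: ringint_int | apply: ringint0].
exists (absz l); first by rewrite absz_gt0.
move: Ol; case: (l) => k; first by rewrite -pmulrn.
by rewrite NegzE mulrNz -pmulrn mulNr => /ringintN; rewrite opprK.
Qed.

Definition independent_mod (l : nat) n (b : 'I_n -> F) : Prop :=
  (forall i, O (b i)) /\
  forall c : 'I_n -> int, O ((\sum_i (c i)%:~R * b i) / l%:R) -> forall i, (l %| c i)%Z.

(* An integral relation between n > [F : Q] elements can be divided by l as long
   as its coefficients are divisible by l. *)
Lemma independent_mod_bound l n (b : 'I_n -> F) : (1 < l)%N ->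
  independent_mod l b -> (n <= \dim {:F})%N.
Proof.
move=> l1 [Ob ind]; rewrite leqNgt; apply/negP => ln; have [c [i nci] sc] := int_dependence b ln.
have nzl : l%:R != 0 :> F by apply: numfield_nat_neq0; apply: ltnW.
have H k : forall c : 'I_n -> int, \sum_i (c i)%:~R * b i = 0 ->
    forall i, ((l ^ k)%N %| c i)%Z.
  elim: k => [|k IH] {i nci sc}c sc i; first by rewrite expn0 dvd1z.
  have dv j : (l %| c j)%Z by apply: ind; rewrite sc mul0r.
  have /IH/(_ i) : \sum_i ((c i %/ l)%Z)%:~R * b i = 0.
    apply: (mulfI nzl); rewrite mulr0 mulr_sumr -[RHS]sc; apply: eq_bigr => j _.
    by rewrite mulrA -{2}(divzK (dv j)) intrM -pmulrn; congr (_ * _); rewrite mulrC.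
  rewrite -{2}(divzK (dv i)) expnSr PoszM => dvi.
  by apply: dvdz_mul.
have := H (absz (c i)) c sc i; rewrite dvdzE /= => /dvdn_leq.
by rewrite absz_gt0 nci leqNgt ltn_expl // => /(_ isT).
Qed.

(** A longest family independent modulo l exists by the degree bound and spans O / l, so a residue
    is recorded by a vector of coefficients below l. *)
Lemma finite_mod_prime (l : nat) : prime l ->
  exists n (phi : F -> 'I_n), forall x y, O x -> O y -> phi x = phi y -> O ((x - y) / l%:R).
Proof.
move=> pl; have l1 := prime_gt1 pl.
have nzl : l%:R != 0 :> F by apply: numfield_nat_neq0; apply: prime_gt0.
have ex : exists n, `[< exists b : 'I_n -> F, independent_mod l b >].
  exists 0%N; apply/asboolP; exists (fun=> 0); split; first by case.
  by move=> c _ [].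
have bd n : `[< exists b : 'I_n -> F, independent_mod l b >] -> (n <= \dim {:F})%N.
  by move/asboolP => [b]; apply: independent_mod_bound.
case: (ex_maxnP ex bd) => n /asboolP [b [Ob ind]] maxn.
have H x : O x -> exists v : {ffun 'I_n -> 'I_l}, O ((x - \sum_i (v i)%:R * b i) / l%:R).
  move=> Ox.
  pose b' i := if unlift ord0 i is Some j then b j else x : F.
  have [c Oc [i nci]] : exists2 c : 'I_n.+1 -> int,
      O ((\sum_i (c i)%:~R * b' i) / l%:R) & exists i, ~~ (l %| c i)%Z.
    apply: contrapT => nex.
    have : (n.+1 <= n)%N; last by rewrite ltnn.
    apply: maxn; apply/asboolP; exists b'; split.
      by move=> i; rewrite /b'; case: unliftP => [j|] _.
    move=> c Oc i; apply: contrapT => /negP nci; apply: nex; exists c => //.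
    by exists i.
  move: Oc; rewrite big_ord_recl {1}/b' unlift_none.
  under eq_bigr do rewrite /b' liftK.
  move=> Oc.
  have nc0 : ~~ (l %| c ord0)%Z.
    apply/negP => dv; have : forall j, (l %| c (lift ord0 j))%Z.
      apply: ind; move: Oc; rewrite mulrDl => Oc.
      rewrite -[X in O X](addKr ((c ord0)%:~R * x / l%:R)) addrC; apply: ringintB => //.
      rewrite mulrAC; apply: ringintM => //.
      rewrite -(divzK dv) intrM -pmulrn mulfK //; exact: ringint_int.
    by move: nci; case: (unliftP ord0 i) => [j|] -> => [/negP|/negP] // + /(_ j).
  have : coprimez (c ord0) l.
    by rewrite coprimezE coprime_sym prime_coprime // -dvdzE.
  (* By maximality the coefficient of x in the relation is prime to l. Its inverse u modulo l
     expresses x through the family; reducing the coefficients modulo l leaves remainders [V] and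
     quotients [e]. *)
  case/coprimezP => -[u w] /= E.
  have l0 : (0 : int) < l%:Z by rewrite ltz_nat prime_gt0.
  have nl0 : l%:Z != 0 by rewrite gt_eqF.
  have Hl (d : int) : exists v : 'I_l, exists e : int, d = (v : nat)%:Z + e * l%:Z.
    have lt0 : (absz (d %% l)%Z < l)%N.
      by rewrite -ltz_nat gez0_abs ?modz_ge0 ?ltz_pmod.
    exists (Ordinal lt0), (d %/ l)%Z; rewrite /= gez0_abs ?modz_ge0 //.
    by rewrite addrC -divz_eq.
  have [V VE] := choice (fun i => Hl (- u * c (lift ord0 i))).
  have [e eE] := choice VE.
  exists [ffun i => V i].
  have -> : (x - \sum_i ([ffun i => V i] i)%:R * b i) / l%:R =
     u%:~R * (((c ord0)%:~R * x + \sum_i (c (lift ord0 i))%:~R * b i) / l%:R)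
     + w%:~R * x + \sum_i (e i)%:~R * b i.
    have Ex : x = (u%:~R * (c ord0)%:~R + w%:~R * l%:R) * x.
      by rewrite [l%:R]pmulrn -!intrM -intrD E mul1r.
    have ES : - \sum_i ([ffun i => V i] i)%:R * b i = u%:~R * \sum_i (c (lift ord0 i))%:~R * b i + \sum_i (e i)%:~R * b i * l%:R.
      rewrite mulr_sumr -big_split /= -sumrN; apply: eq_bigr => j _; rewrite ffunE.
      have := congr1 (fun z : int => z%:~R : F) (eE j).
      rewrite intrM intrD intrM mulrNz -!pmulrn => EE.
      have -> : (V j : nat)%:R = - u%:~R * (c (lift ord0 j))%:~R - (e j)%:~R * l%:R :> F.
        by rewrite EE addrK.
      by move: u%:~R (e j)%:~R (c _)%:~R => u' e' c'; ring.
    rewrite ES {1}Ex -mulr_suml.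
    move: (\sum_i _) (\sum_i _) => S1 S2; move: u%:~R w%:~R (c ord0)%:~R => u' w' c'.
    by field.
  apply: ringintD; last by apply: ringint_sum => j _; apply: ringintM => //; apply: ringint_int.
  by apply: ringintD; apply: ringintM => //; apply: ringint_int.
pose v x := xget [ffun=> Ordinal (prime_gt0 pl)] [set v : {ffun 'I_n -> 'I_l} | O ((x - \sum_i (v i)%:R * b i) / l%:R)]%classic.
have vP x : O x -> O ((x - \sum_i (v x i)%:R * b i) / l%:R).
  by move=> /H [u Hu]; rewrite /v; case: xgetP => [? -> //|/(_ u)].
exists #|{ffun 'I_n -> 'I_l}|, (fun x => enum_rank (v x)) => x y Ox Oy /enum_rank_inj E.
have -> : (x - y) / l%:R = (x - \sum_i (v x i)%:R * b i) / l%:R - (y - \sum_i (v y i)%:R * b i) / l%:R.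
  by rewrite E; ring.
by apply: ringintB; apply: vP.
Qed.

(** Induction on m = q l with l prime: x modulo q l is determined by its residue modulo l together
    with the residue modulo q of (x - r) / l, where r represents the first residue. *)
Lemma numfield_finite_quotients : finite_quotients F.
Proof.
move=> m; have [k] := ubnP m; elim: k m => // k IH m mk m0.
split; first exact: numfield_nat_neq0.
case: (leqP m 1) => [m1|m1].
  have -> : m = 1%N by apply/eqP; rewrite eqn_leq m1.
  by exists 1%N, (fun=> ord0) => x y Ox Oy _; rewrite divr1; apply: ringintB.
have pl := pdiv_prime m1; set l := pdiv m in pl.
have [q qm] : exists q, m = (q * l)%N by exists (m %/ l)%N; rewrite divnK // pdiv_dvd.
have q0 : (0 < q)%N by move: m0; rewrite qm muln_gt0 => /andP[].
have [|_ [n2 [f2 H2]]] := IH q _ q0.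
  by rewrite (leq_trans _ (mk : m <= k)%N) // qm ltn_Pmulr // prime_gt1.
have [n1 [f1 H1]] := finite_mod_prime pl.
pose r i := xget 0 [set x : F | O x /\ f1 x = i]%classic.
have rO i : O (r i) by rewrite /r; case: xgetP => [x -> []|] //.
have rP x : O x -> O ((x - r (f1 x)) / l%:R).
  move=> Ox; apply: H1 => //; rewrite /r; case: xgetP => [y -> []|/(_ x)] //.
  by case.
exists #|{: 'I_n1 * 'I_n2}|, (fun x => enum_rank (f1 x, f2 ((x - r (f1 x)) / l%:R))).
move=> x y Ox Oy /enum_rank_inj [E1 E2].
have nzl : l%:R != 0 :> F by apply: numfield_nat_neq0; apply: prime_gt0.
have nzq : q%:R != 0 :> F by apply: numfield_nat_neq0.
have := H2 _ _ (rP x Ox) (rP y Oy) E2; rewrite E1 qm natrM; congr O.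
by field; apply/andP.
Qed.

End NumberField.

Lemma ext_finite_quotients (K : fieldExtType rat) (L : fieldExtType K) : finite_quotients L.
Proof. exact: (@numfield_finite_quotients (baseFieldType L)). Qed.

Lemma ext_scale_ringint (K : fieldExtType rat) (L : fieldExtType K) (x : L) :
  exists2 m : nat, (0 < m)%N & ringint (m%:R * x).
Proof. exact: (@numfield_scale_ringint (baseFieldType L)). Qed.

(** * Trivial ray class group *)

Section PrincipalIdeals.
Variable F : fieldType.
Implicit Types (x y g : F) (I m : set F).
Local Notation O := (@ringint F).

Lemma principalP g x : g != 0 -> principal g x <-> O (x / g).
Proof.
move=> nzg; split; first by move=> [y Oy <-]; rewrite mulrC mulKf.
by move=> Oxg; exists (x / g) => //; rewrite mulrC divfK.
Qed.

Lemma ideal_principal_int g : O g -> ideal (principal g).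
Proof.
move=> Og; split; [split|].
- by exists 0; rewrite ?mulr0.
- by move=> _ _ [x Ox <-] [y Oy <-]; exists (x + y); rewrite ?mulrDr; auto.
- by move=> a _ Oa [x Ox <-]; exists (a * x); rewrite 1?mulrCA; auto.
- by move=> _ [x Ox <-]; auto.
Qed.

Lemma principal_id g : principal g g.
Proof. by exists 1; rewrite ?mulr1. Qed.

Lemma ideal_int : ideal O.
Proof. by split; [split; auto|]. Qed.

Lemma ideal_frac I : ideal I -> nonzero I -> frac_ideal I.
Proof.
move=> [sI IO] nI; split => //; exists 1; split => //; first exact: oner_neq0.
by move=> x /IO; rewrite mul1r.
Qed.

Lemma idealM_int I : submod I -> idealM I O = I.
Proof.
move=> [I0 ID IM]; apply/seteqP; split => x.
  move=> [n [a [m [Ia Om ->]]]]; apply: big_ind => // i _.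
  by rewrite mulrC; apply: IM.
move=> Ix; exists 1%N, (fun=> x), (fun=> 1); split => //.
by rewrite big_ord1 mulr1.
Qed.

Lemma frac_coprime_ideal m I : submod m -> ideal I -> nonzero I -> coprime_to m I ->
  frac_coprime_to m I.
Proof.
move=> [m0 _ _] iI nI cI; split; first exact: ideal_frac.
exists I, O; split => //.
- by split; [exact: ideal_int | exists 1; rewrite ?oner_neq0].
- by exists 1, 0; rewrite addr0.
- by apply: idealM_int; case: iI.
Qed.

Lemma idealM_principal g h : idealM (principal g) (principal h) = principal (g * h).
Proof.
apply/seteqP; split => x.
  move=> [n [a [m [Ia Om ->]]]].
  pose I : set F := principal (g * h).
  apply: (big_ind I) => [||i _].
  - by exists 0; rewrite ?mulr0.
  - by move=> _ _ [u Ou <-] [v Ov <-]; exists (u + v); rewrite ?mulrDr; auto.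
  - have [u Ou <-] := Ia i; have [v Ov <-] := Om i; exists (u * v); auto; ring.
move=> [y Oy <-]; exists 1%N, (fun=> g), (fun=> h * y); split => [_|_|].
- exact: principal_id.
- by exists y.
- by rewrite big_ord1 mulrA.
Qed.

Lemma idealX_principal g n : idealX (principal g) n = principal (g ^+ n).
Proof.
elim: n => [|n IH].
  rewrite /idealX /= expr0; apply/seteqP; split => [x Ox|_ [x Ox <-]]; rewrite ?mul1r //.
  by exists x; rewrite ?mul1r.
by rewrite /idealX iterS -/(idealX _ n) IH idealM_principal exprS.
Qed.

End PrincipalIdeals.

Section TrivialRayClassGroup.
Variable K : fieldExtType rat.
Hypothesis ray_trivial : ray_class_group_trivial (principal (4%:R : K)).
Implicit Types (x y g u : K) (I : set K).
Local Notation O := (@ringint K).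

Let nz4 : 4%:R != 0 :> K. Proof. exact: numfield_nat_neq0. Qed.
Let finK := numfield_finite_quotients K.

Lemma frac_coprime_int : frac_coprime_to (principal (4%:R : K)) O.
Proof.
apply: frac_coprime_ideal.
- by case: (ideal_principal_int (ringint_nat K 4)).
- exact: ideal_int.
- by exists 1; rewrite ?oner_neq0.
- by exists 1, 0; split; rewrite ?addr0 //; exists 0; rewrite ?mulr0.
Qed.

(** Only ideals prime to 4 have a ray class, so I is first scaled to such an ideal y I. *)
Lemma ideal_principal I : ideal I -> nonzero I ->
  exists2 g, g != 0 & I = principal g.
Proof.
move=> idI nzI; have [[I0 ID IM] IO] := idI.
have [y [nzy [yI [x0 Ix0 [t Ot E]]]]] : exists y, y != 0 /\ (forall x, I x -> O (y * x)) /\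
    exists2 x, I x & exists2 t, O t & y * x + 4%:R * t = 1.
  have [y [yI [x0 Ix0 [t Ot E]]]] := ideal_scale_coprime finK idI nzI (ringint_nat _ 4) nz4.
  have [y0|nzy] := eqVneq y 0; last by exists y; do 2?split => //; exists x0 => //; exists t.
  (* If y = 0 then 4 t = 1, every ideal is prime to 4, and y = 1 will do. *)
  exists 1; rewrite oner_neq0; do 2?split => //; first by move=> x /IO; rewrite mul1r.
  by exists 0 => //; exists t => //; move: E; rewrite y0 mul0r mulr0.
have idA : ideal (dilate y I).
  split; [split|].
  - by exists 0; rewrite ?mulr0.
  - by move=> _ _ [u Iu <-] [v Iv <-]; exists (u + v); rewrite ?mulrDr; auto.
  - by move=> a _ Oa [u Iu <-]; exists (a * u); rewrite 1?mulrCA; auto.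
  - by move=> _ [u Iu <-]; auto.
have nzA : nonzero (dilate y I).
  by case: nzI => c Ic nzc; exists (y * c); rewrite ?mulf_neq0 //; exists c.
have cA : coprime_to (principal (4%:R : K)) (dilate y I).
  exists (y * x0), (4%:R * t); split => //; first by exists x0.
  by exists t.
have [|x [a [b [[Oa nza] [Ob nzb] _ _ [_ xE]]]] AE] := ray_trivial _ frac_coprime_int (I := dilate y I).
  by apply: frac_coprime_ideal => //; case: (ideal_principal_int (ringint_nat K 4)).
have nzx : x != 0 by rewrite xE mulf_neq0 ?invr_neq0.
exists (x / y); first by rewrite mulf_neq0 ?invr_neq0.
apply/seteqP; split => z.
  move=> Iz; have : dilate y I (y * z) by exists z.
  rewrite AE => -[u Ou E1]; exists u => //.
  by apply: (mulfI nzy); rewrite -E1; field.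
move=> [u Ou <-]; have : dilate x O (x * u) by exists u.
rewrite -AE => -[v Iv E1]; have -> : x / y * u = v; last by [].
by apply: (mulfI nzy); rewrite E1; field.
Qed.

(** The ideal (t) is prime to 4, hence equal to (x) with x = 1 modulo 4 in the multiplicative sense;
    the unit is u = t / x. *)
Lemma unit_mod4 t s r : O t -> O s -> O r -> t * s + 4%:R * r = 1 ->
  exists u, [/\ u != 0, O u, O u^-1 & O ((u - t) / 4%:R)].
Proof.
move=> Ot Os Or E.
case: (eqVneq t 0) => [t0|nzt].
  move: E; rewrite t0 mul0r add0r => E; exists 1; split; rewrite ?oner_neq0 ?invr1 ?subr0 //.
  suff -> : 1 / 4%:R = r by [].
  by apply: (mulfI nz4); rewrite E mulrC divfK.
have [|x [a [b [[Oa nza] [Ob nzb] _ [b' [q [[b1 Ob1 <-] [q1 Oq1 <-] E1]]] [[d Od dE] xE]]]] AE] := ray_trivial _ frac_coprime_int (I := principal t).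
  apply: frac_coprime_ideal.
  - by case: (ideal_principal_int (ringint_nat K 4)).
  - exact: ideal_principal_int.
  - by exists t => //; apply: principal_id.
  - exists (t * s), (4%:R * r); split => //; first by exists s.
    by exists r.
have nzx : x != 0 by rewrite xE mulf_neq0 ?invr_neq0.
have : dilate x O t by rewrite -AE; apply: principal_id.
move=> [u Ou tE].
have : principal t x by rewrite AE; exists 1; rewrite ?mulr1.
move=> [v Ov vE].
have nzu : u != 0 by apply: contraNneq nzt => u0; rewrite -tE u0 mulr0.
have uv : u^-1 = v.
  by apply: (mulfI nzu); apply: (mulfI nzx); rewrite divff // mulrA tE vE mulr1.
exists u; split; rewrite ?uv //.
have -> : (u - t) / 4%:R = (u - t) * q1 - d * u * b1.
  apply: (mulIf nz4); rewrite divfK //.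
  transitivity ((u - t) * (b * b1 + 4%:R * q1)); first by rewrite E1 mulr1.
  have bt : b * t = (b + 4%:R * d) * u by rewrite dE -tE xE; field.
  have -> : (u - t) * (b * b1 + 4%:R * q1) = (b * u - b * t) * b1 + (u - t) * q1 * 4%:R by ring.
  by rewrite bt; ring.
auto.
Qed.
End TrivialRayClassGroup.

(** * Inertia and ramification *)

Section IdealPowers.
Variables (F : fieldType) (P : set F).
Hypothesis primeP : prime_ideal P.
Local Notation O := (@ringint F).

Lemma idealX_submod n : submod (idealX P n).
Proof.
case: n => [|n]; first by case: (ideal_int F).
rewrite /idealX iterS -/(idealX P n); split.
- by exists 0%N, (fun=> 0), (fun=> 0); split => [[]|[]|] //; rewrite big_ord0.
- move=> _ _ [n1 [a1 [m1 [Pa1 Im1 ->]]]] [n2 [a2 [m2 [Pa2 Im2 ->]]]].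
  exists (n1 + n2)%N.
  exists (fun i => match fintype.split i with inl j => a1 j | inr j => a2 j end).
  exists (fun i => match fintype.split i with inl j => m1 j | inr j => m2 j end).
  split; try by move=> i; case: (fintype.split i).
  rewrite big_split_ord /=; congr (_ + _); apply: eq_bigr => i _.
    by have := unsplitK (inl i : 'I_n1 + 'I_n2) => /= ->.
  by have := unsplitK (inr i : 'I_n1 + 'I_n2) => /= ->.
- move=> a _ Oa [n1 [a1 [m1 [Pa1 Im1 ->]]]].
  exists n1, (fun i => a * a1 i), m1; split => //.
    by move=> i; apply: (primeMl primeP).
  by rewrite mulr_sumr; apply: eq_bigr => i _; rewrite mulrA.
Qed.

Lemma idealXM n a x : P a -> idealX P n x -> idealX P n.+1 (a * x).
Proof.
by move=> Pa Ix; exists 1%N, (fun=> a), (fun=> x); split; rewrite ?big_ord1.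
Qed.

Lemma idealXX n a x : P a -> O x -> idealX P n (a ^+ n * x).
Proof.
move=> Pa Ox; elim: n => [|n IH]; first by rewrite expr0 mul1r.
by rewrite exprS -mulrA; apply: idealXM.
Qed.

Lemma idealX_scale n z x : (forall y, P y -> O (z * y)) -> idealX P n x -> O (z ^+ n * x).
Proof.
move=> zP; elim: n x => [|n IH] x; first by rewrite expr0 mul1r.
move=> [k [a [m [Pa Im ->]]]]; rewrite mulr_sumr; apply: ringint_sum => i _.
by rewrite exprS mulrACA; apply: ringintM; [exact: zP | exact: IH (Im i)].
Qed.

End IdealPowers.

(* z is the inverse of a uniformizer at P up to a local unit, l is a
   uniformizer, and s is an involution in the inertia group of P. *)
Section Inertia.
Variables (F : fieldType) (P : set F) (s : {rmorphism F -> F}) (z l : F).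
Hypotheses (finF : finite_quotients F) (primeP : prime_ideal P) (P2 : P 2%:R).
Hypotheses (sK : involutive s) (sP : forall x, ringint x -> P (s x - x)).
Hypotheses (zP : forall x, P x -> ringint (z * x)) (Pl : P l) (nPm : ~ P (z * l)) (nOz : ~ ringint z).
Local Notation O := (@ringint F).

(** The localisation of O at P. *)
Let inR x := exists t, [/\ O t, ~ P t & O (t * x)].

Lemma local_ringint x : O x -> inR x.
Proof. by move=> Ox; exists 1; rewrite mul1r; split => //; apply: prime_n1. Qed.

Lemma localM x y : inR x -> inR y -> inR (x * y).
Proof.
move=> [t [Ot nt Otx]] [u [Ou nu Ouy]]; exists (t * u); split; auto.
  exact: primeM_not.
by rewrite mulrACA; auto.
Qed.

Lemma localX x n : inR x -> inR (x ^+ n).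
Proof.
move=> Rx; elim: n => [|n IH]; first by rewrite expr0; apply: local_ringint.
by rewrite exprS; apply: localM.
Qed.

Lemma localV x : O x -> ~ P x -> inR x^-1.
Proof. by move=> Ox nx; exists x; rewrite divff //; apply: prime_not0 nx. Qed.

Lemma s_int x : O x -> O (s x).
Proof.
by move=> Ox; rewrite -(subrK x (s x)); apply: ringintD => //; apply: prime_int (sP Ox).
Qed.

Lemma s_notP x : O x -> ~ P x -> ~ P (s x).
Proof.
move=> Ox nx Ps; apply: nx; rewrite -(subKr (s x) x); apply: primeB => //.
exact: sP.
Qed.

Lemma not_local_z : ~ inR z.
Proof.
move=> [t [Ot nt Otz]].
have : P (t * (z * l)) by rewrite mulrA; apply: primeMl.
by case/(primeM_or primeP) => //; apply: zP.
Qed.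

(** The number m is the valuation of c at P. *)
Lemma scale_max c : O c -> c != 0 ->
  exists m, [/\ O (z ^+ m * c), ~ O (z ^+ m.+1 * c) & ~ P (z ^+ m * c)].
Proof.
move=> Oc nzc.
have ex : exists n, ~~ `[< O (z ^+ n * c) >].
  apply: contrapT => H; apply: nOz; apply: (almost_integral finF nzc) => n.
  rewrite mulrC; apply: contrapT => nn; apply: H; exists n; exact/asboolPn.
case: (ex_minnP ex) => -[|m] /asboolPn nm minm; first by rewrite expr0 mul1r in nm.
exists m; split => //.
  by apply/asboolP; apply: contrapT => /negP /minm; rewrite ltnn.
by move=> Pm; apply: nm; rewrite exprS -mulrA; apply: zP.
Qed.

Lemma sqr_injP a b i : O a -> O b -> P (a ^+ (2 ^ i) - b ^+ (2 ^ i)) -> P (a - b).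
Proof.
elim: i a b => [|i IH] a b Oa Ob; first by rewrite expn0 !expr1.
rewrite expnS !exprM => /IH H; apply: (@prime_X _ _ primeP _ 2); auto.
have -> : (a - b) ^+ 2 = (a ^+ 2 - b ^+ 2) - (b * (a - b)) * 2%:R by ring.
by apply: primeB => //; [apply: H; auto | apply: (primeMl primeP); auto].
Qed.

(** The residue field is finite of characteristic 2, hence perfect: two iterated squares of y agree
    modulo P, and squaring is injective there. *)
Lemma sqr_surjP y : O y -> exists2 y1, O y1 & P (y - y1 ^+ 2).
Proof.
move=> Oy; have [_ [c Pc nzc] _ _] := primeP.
have [i [j [lij Oij]]] := pigeonhole finF (prime_int primeP Pc) nzc (fun n => ringintX (2 ^ n)%N Oy).
exists (y ^+ (2 ^ (j - i).-1)); first by auto.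
rewrite -exprM -expnSr prednK ?subn_gt0 //.
apply: (@sqr_injP _ _ i); auto.
rewrite -exprM -expnD subnK ?(ltnW lij) //.
by rewrite -(divfK nzc (_ - _)); apply: (primeMl primeP).
Qed.

(** Since s is trivial modulo P, a square y1^2 is congruent to the s-invariant element y1 s(y1). The
    last condition says that x - N is in P locally. *)
Lemma local_norm_residue x : inR x -> exists2 N, s N = N & inR (z * (x - N)).
Proof.
move=> [t [Ot nt Otx]]; have [u Ou Pu] := prime_maximal finF primeP Ot nt.
have [y1 Oy1 Py] := sqr_surjP (ringintM Ou Otx).
exists (y1 * s y1); first by rewrite rmorphM sK mulrC.
have -> : z * (x - y1 * s y1) =
   z * ((u * (t * x) - y1 ^+ 2) - y1 * (s y1 - y1)) + (z * (1 - u * t)) * x by ring.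
have O1 : O (z * (u * (t * x) - y1 ^+ 2 - y1 * (s y1 - y1))).
  by apply: zP; apply: primeB => //; apply: primeMl => //; apply: sP.
have O2 : O (z * (1 - u * t)) by apply: zP.
exists t; split => //; rewrite mulrDr; apply: ringintD; auto.
by rewrite mulrCA; auto.
Qed.

(* Modulo P every integer is a square, hence a norm N = y s(y): writing
   x = N + w x', iteratively, makes s x - x divisible by all powers of w. *)
Lemma no_fixed_uniformizer w : s w = w -> inR (z * w) -> inR (z * w)^-1 -> w != 0 ->
  forall x, O x -> s x = x.
Proof.
move=> sw Rw Rw1 nzw.
have nzz : z != 0 by apply/eqP => z0; apply: nOz; rewrite z0.
have H n : forall x, inR x -> inR ((s x - x) / w ^+ n).
  elim: n => [|n IH] x Rx.
    rewrite expr0 divr1; have [t [Ot nt Otx]] := Rx.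
    exists (t * s t); split; first by apply: ringintM => //; apply: s_int.
      apply: primeM_not => //; [exact: s_int | exact: s_notP].
    have -> : t * s t * (s x - x) = t * s (t * x) - s t * (t * x) by rewrite rmorphM; ring.
    by apply: ringintB; apply: ringintM => //; apply: s_int.
  have [N sN RN] := local_norm_residue Rx.
  have := IH ((x - N) / w); rewrite fmorph_div rmorphB sN sw.
  have -> : (x - N) / w = (z * (x - N)) * (z * w)^-1 by field; apply/andP.
  move=> /(_ (localM RN Rw1)); congr inR.
  by rewrite exprS; field; rewrite expf_neq0 // nzw nzz.
move=> x Ox; apply: contrapT => /eqP; rewrite -subr_eq0 => nzD.
(* Local divisibility of s x - x by w^(m + 1), one more than its valuation m, would make z itself
   local. *)
have [m [Om _ nPm']] := scale_max (ringintB (s_int Ox) Ox) nzD.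
apply: not_local_z.
have := localM (localM (H m.+1 x (local_ringint Ox)) (localX m.+1 Rw)) (localV Om nPm').
congr inR; rewrite exprMn !exprS; field.
by rewrite !expf_neq0 ?nzw ?nzz ?nzD.
Qed.

(* If c had odd valuation 2 k + 1, then c / (l s(l))^k would be a uniformizer
   fixed by s. *)
Lemma inertia_even c : O c -> c != 0 -> s c = c -> (exists2 x, O x & s x != x) ->
  exists e, [/\ (2 %| e)%N, idealX P e c & ~ idealX P e.+1 c].
Proof.
move=> Oc nzc sc [x0 Ox0 /eqP nsx].
have [e [Oe nOe nPe]] := scale_max Oc nzc.
have nzz : z != 0 by apply/eqP => z0; apply: nOz; rewrite z0.
have nzl : l != 0 by apply/eqP => l0; apply: nPm; rewrite l0 mulr0; apply: prime0.
have nzsl : s l != 0 by rewrite fmorph_eq0.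
exists e; split; last 1 first.
- by move=> /(idealX_scale zP).
- apply: contrapT => odde.
  have [k ek] : exists k, e = k.*2.+1.
    by exists e./2; rewrite -[LHS]odd_double_half; move: odde; rewrite dvdn2 => /negP; rewrite negbK => ->.
  have Psl : P (s l).
    by rewrite -(subrK l (s l)); apply: primeD => //; apply: sP; apply: prime_int Pl.
  have Om := zP Pl; have Ot := zP Psl.
  have nPt : ~ P (z * s l).
    move=> Pt; have : P (z * l * s (z * l)).
      have -> : z * l * s (z * l) = (z * s l) * s (z * s l) by rewrite !rmorphM sK; ring.
      by apply: (primeMr primeP) => //; apply: s_int.
    by apply: primeM_not => //; [apply: s_int | apply: s_notP].
  pose d := (z * l) * (z * s l).
  have Od : O (d ^+ k) by apply: ringintX; apply: ringintM.
  have nPd : ~ P (d ^+ k) by move/(prime_X primeP (ringintM Om Ot)); apply: primeM_not.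
  pose w := c / (l * s l) ^+ k.
  have zwE : z * w = (z ^+ e * c) / d ^+ k.
    rewrite /w /d ek exprS -mul2n exprM; have -> : z * l * (z * s l) = z ^+ 2 * (l * s l) by ring.
    rewrite [(z ^+ 2 * _) ^+ k]exprMn.
    have : (z ^+ 2) ^+ k != 0 by rewrite !expf_neq0.
    have : (l * s l) ^+ k != 0 by rewrite expf_neq0 ?mulf_neq0.
    move: ((z ^+ 2) ^+ k) ((l * s l) ^+ k) => Z M nzM nzZ.
    by field; rewrite nzM nzZ.
  apply: nsx; apply: (@no_fixed_uniformizer w) => //.
  + by rewrite /w fmorph_div rmorphXn rmorphM sK sc mulrC [s l * l]mulrC mulrC.
  + by rewrite zwE; apply: localM; [apply: local_ringint | apply: localV].
  + rewrite zwE invf_div; apply: localM; [exact: local_ringint | exact: localV].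
  + by rewrite /w mulf_neq0 ?invr_neq0 ?expf_neq0 ?mulf_neq0.
- have Om := zP Pl.
  have nPme : ~ P ((z * l) ^+ e) by move/(prime_X primeP Om).
  have [u Ou Pu] := prime_maximal finF primeP (ringintX e Om) nPme.
  set r := 1 - u * (z * l) ^+ e in Pu.
  have [_ ID IM] := idealX_submod primeP e.
  (* Membership in P^e: 1 - r^e is a multiple of 1 - r = u (z l)^e, so c is a combination of l^e and
     r^e with l and r in P. *)
  have -> : c = (\sum_(i < e) r ^+ i) * u * (l ^+ e * (z ^+ e * c)) + r ^+ e * c.
    have E := subrX1 r e.
    have {1}-> : c = (1 - r ^+ e) * c + r ^+ e * c by ring.
    congr (_ + _); rewrite -[1 - _]opprB E /r exprMn; ring.
  have Or := prime_int primeP Pu.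
  apply: ID; last exact: idealXX.
  apply: IM; last exact: idealXX.
  by apply: ringintM => //; apply: ringint_sum => i _; auto.
Qed.

End Inertia.

Lemma ringint_rmorph (E F : fieldType) (f : {rmorphism E -> F}) x :
  ringint (f x) <-> ringint x.
Proof.
have H p : root (map_poly (intr : int -> F) p) (f x) = root (map_poly (intr : int -> E) p) x.
  have -> : map_poly (intr : int -> F) p = map_poly f (map_poly intr p).
    by rewrite -map_poly_comp; apply: eq_map_poly => n /=; rewrite rmorph_int.
  by rewrite fmorph_root.
by split=> -[p mp px]; exists p => //; move: px; rewrite H.
Qed.

Lemma ringint_alg (K : fieldType) (L : fieldExtType K) (y : K) :
  ringint (y%:A : L) <-> ringint y.
Proof. exact: (ringint_rmorph (in_alg L)). Qed.

(** * Normal integral bases *)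

Section KleinGroup.
Variables (gT : finGroupType) (G : {group gT}).
Local Open Scope group_scope.

Lemma klein_group_elements : (forall g, g \in G) -> G \isog C2xC2 ->
  exists s t : gT,
    [/\ uniq [:: 1; s; t; s * t], forall g, g \in [:: 1; s; t; s * t],
        s * s = 1, t * t = 1 & s * t = t * s].
Proof.
move=> inG isoG.
have sq (g : gT) : g * g = 1.
  have [f injf imf] := isogP isoG.
  have fsq (x : 'Z_2 * 'Z_2) : (x * x = 1)%g.
    by case: x => [[[|[|//]] ?] [[|[|//]] ?]]; apply/eqP; rewrite xpair_eqE -!val_eqE.
  apply: (injmP injf); rewrite ?groupM ?group1 // morphM // morph1.
  exact: fsq.
have comm (g h : gT) : g * h = h * g.
  have inv (k : gT) : k^-1 = k by apply/eqP; rewrite eq_invg_mul; apply/eqP; apply: sq.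
  by rewrite -{1}(inv (g * h)) invMg !inv.
have card4 : #|gT| = 4%N.
  have <- : #|G| = #|gT| by apply: eq_card => g; rewrite inG.
  by rewrite (card_isog isoG) cardsT card_prod !card_ord.
have cardle (r : seq gT) : (forall g, g \in r) -> (4 <= size r)%N.
  move=> Hr; rewrite -card4; apply: leq_trans (card_size r).
  by apply/subset_leq_card/fintype.subsetP => g _; apply: Hr.
have [s s1] : exists s : gT, s != 1.
  apply: contrapT => nex; have : (4 <= 1)%N; last by [].
  apply: (cardle [:: 1]) => g; rewrite inE.
  by apply: contrapT => /negP ng; apply: nex; exists g.
have [t ts] : exists t : gT, t \notin [:: 1; s].
  apply: contrapT => nex; have : (4 <= 2)%N; last by [].
  apply: (cardle [:: 1; s]) => g.
  by apply: contrapT => /negP ng; apply: nex; exists g.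
have [t1 nts] : t != 1 /\ t != s by move: ts; rewrite !inE negb_or => /andP.
have U : uniq [:: 1; s; t; s * t].
  rewrite /= !inE !negb_or !(eq_sym 1) s1 t1 (eq_sym s t) nts /= andbT.
  have -> : s != s * t by rewrite -{1}[s]mulg1 (inj_eq (mulgI _)) eq_sym.
  have -> : t != s * t by rewrite -{1}[t]mul1g (inj_eq (mulIg _)) eq_sym.
  rewrite !andbT; apply: contra nts => /eqP E; apply/eqP; apply: (mulgI s).
  by rewrite E sq.
exists s, t; split; [exact: U | | exact: sq | exact: sq | exact: comm].
move=> g.
have E : #|[:: 1; s; t; s * t]| = #|gT| by rewrite (card_uniqP U) card4.
have /(subset_cardP E) -> // : [:: 1; s; t; s * t] \subset gT.
by apply/fintype.subsetP.
Qed.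

Lemma klein_isog (s t : gT) : (forall g, g \in G) ->
    uniq [:: 1; s; t; s * t] -> (forall g, g \in [:: 1; s; t; s * t]) ->
    s * s = 1 -> t * t = 1 -> s * t = t * s ->
  G \isog C2xC2.
Proof.
move=> inG U inU ss tt st.
have sq (g : gT) : g * g = 1.
  have := inU g; rewrite !inE => /or4P[] /eqP-> //; first by rewrite mulg1.
  by rewrite {2}st -mulgA (mulgA t) tt mul1g.
have comm (g h : gT) : g * h = h * g.
  have inv (k : gT) : k^-1 = k by apply/eqP; rewrite eq_invg_mul; apply/eqP; apply: sq.
  by rewrite -{1}(inv (g * h)) invMg !inv.
have c4 : #|G| = 4%N.
  by rewrite -[4%N]/(size [:: 1; s; t; s * t]) -(card_uniqP U); apply: eq_card => g; rewrite inU inG.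
have abelemG : 2.-abelem G.
  rewrite abelemE //; apply/andP; split.
    by apply/centsP => g _ h _; apply: comm.
  by apply/exponentP => g _; rewrite expgS expg1 sq.
have abelemC : 2.-abelem C2xC2.
  rewrite abelemE //; apply/andP; split.
    apply/centsP => -[a b] _ [c d] _; apply/eqP; rewrite xpair_eqE; apply/andP.
    by split; apply/eqP; apply: (@addrC 'Z_2).
  apply/exponentP => x _; rewrite expgS expg1.
  by case: x => [[[|[|//]] ?] [[|[|//]] ?]]; apply/eqP; rewrite xpair_eqE -!val_eqE.
rewrite (isog_abelem_card _ abelemG) abelemC /= c4.
by rewrite cardsT card_prod !card_ord.
Qed.

End KleinGroup.

Section KleinExtension.
Variables (K : fieldType) (L : splittingFieldType K).

Lemma mem_gal1 (g : gal_of {:L}) : g \in 'Gal({:L} / 1)%g.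
Proof. by rewrite gal_kHom ?sub1v // k1AHom. Qed.

Section Elements.
Variables s t : gal_of {:L}.
Hypotheses (U : uniq [:: 1; s; t; s * t]%g) (inU : forall g, g \in [:: 1; s; t; s * t]%g).

Lemma klein_sum (V : zmodType) (f : gal_of {:L} -> V) :
  \sum_(g in 'Gal({:L} / 1)%g) f g = f 1%g + f s + f t + f (s * t)%g.
Proof.
have -> : \sum_(g in 'Gal({:L} / 1)%g) f g = \sum_(g <- [:: 1; s; t; s * t]%g) f g.
  rewrite [RHS]big_uniq //; apply: eq_bigl => g.
  by rewrite mem_gal1 inU.
by rewrite !big_cons big_nil addr0 !addrA.
Qed.

Lemma klein_act (a : group_ring L) y :
  group_ring_act a y = in_alg L (a 1%g) * y + in_alg L (a s) * s y
    + in_alg L (a t) * t y + in_alg L (a (s * t)%g) * t (s y).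
Proof.
rewrite /group_ring_act klein_sum gal_id galM ?memvf //.
by rewrite -!(scalerAl _ 1) !mul1r.
Qed.

Lemma klein_fixed (x : L) : galois 1%VS {:L}%VS -> s x = x -> t x = x ->
  exists y : K, x = in_alg L y.
Proof.
move=> galL sx tx; have : x \in (1%VS : {vspace L}).
  rewrite -(galois_fixedField galL); apply/fixedFieldP; first exact: memvf.
  move=> g _; have := inU g; rewrite !inE => /or4P[] /eqP ->; rewrite ?gal_id //.
  by rewrite galM ?memvf // sx.
by move/vlineP => [y ->]; exists y.
Qed.

Lemma klein_neq : [/\ s != 1, t != 1 & s * t != 1]%g /\ [/\ t != s, s * t != s & s * t != t]%g.
Proof.
move: U; rewrite /= !inE !negb_or !andbT => /and3P[/and3P[n1 n2 n3] /andP[n4 n5] n6].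
by split; split; rewrite eq_sym.
Qed.

End Elements.
End KleinExtension.

(** * Eigenlattices, trace and inertia in a tame biquadratic extension *)

Section TameKlein.
Variables (K : fieldExtType rat) (L : fieldExtType K).
Variables (S T : {rmorphism L -> L}).
Hypotheses (SK : involutive S) (TK : involutive T) (ST : forall x, S (T x) = T (S x)).
Variable i : {rmorphism K -> L}.
Hypothesis iE : forall y : K, y%:A = i y.
Hypotheses (SA : forall y, S (i y) = i y) (TA : forall y, T (i y) = i y).
Hypothesis fixK : forall x : L, S x = x -> T x = x -> exists y : K, x = i y.
Hypothesis ray_trivial : ray_class_group_trivial (principal (4%:R : K)).
Local Notation OK := (@ringint K).
Local Notation O := (@ringint L).

Let finL := ext_finite_quotients L.
Let finK := numfield_finite_quotients K.
Let nz n : (0 < n)%N -> n%:R != 0 :> L.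
Proof. by move=> n0; case: (finL n0). Qed.
Let OS x : O x -> O (S x). Proof. by move=> Ox; apply/ringint_rmorph. Qed.
Let OT x : O x -> O (T x). Proof. by move=> Ox; apply/ringint_rmorph. Qed.

(** Multiplication by an integral eigenvector A1 carries the integral eigenvectors onto an ideal of
    O_K, because the signs square to 1. That ideal is principal, and its generator divided by A1
    generates the eigenlattice. *)
Lemma eigen_generator (ep de A0 : L) : ep ^+ 2 = 1 -> de ^+ 2 = 1 -> A0 != 0 ->
    S A0 = ep * A0 -> T A0 = de * A0 ->
  exists A, [/\ A != 0, O A, S A = ep * A, T A = de * A &
    forall x, O x -> S x = ep * x -> T x = de * x -> exists2 y : K, OK y & x = i y * A].
Proof.
move=> ep2 de2 nzA0 SA0 TA0.
have nzep : ep != 0 by apply: contra_eq_neq ep2 => ->; rewrite expr0n eq_sym oner_neq0.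
have nzde : de != 0 by apply: contra_eq_neq de2 => ->; rewrite expr0n eq_sym oner_neq0.
have [m m0 OA0] := ext_scale_ringint A0.
pose A1 := m%:R * A0.
have nzA1 : A1 != 0 by rewrite mulf_neq0 ?nz.
have SA1 : S A1 = ep * A1 by rewrite /A1 rmorphM rmorph_nat SA0 mulrCA.
have TA1 : T A1 = de * A1 by rewrite /A1 rmorphM rmorph_nat TA0 mulrCA.
have [n nE] : exists n, A1 ^+ 2 = i n.
  by apply: fixK; rewrite rmorphXn /= ?SA1 ?TA1 exprMn ?ep2 ?de2 mul1r.
have On : OK n by apply/(ringint_rmorph i); rewrite -nE; auto.
have nzn : n != 0 by move: nE; apply: contra_eq_neq => ->; rewrite rmorph0 expf_neq0.
pose I := [set y : K | OK y /\ O (i y / A1)].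
have idI : ideal I.
  split; [split|] => /=.
  - by split; rewrite ?rmorph0 ?mul0r.
  - by move=> x y [Ox Ix] [Oy Iy]; split; rewrite ?rmorphD ?mulrDl; auto.
  - move=> a x Oa [Ox Ix]; split; auto.
    by rewrite rmorphM -mulrA; apply: ringintM => //; apply/(ringint_rmorph i).
  - by move=> x [].
have [|g nzg IE] := ideal_principal ray_trivial idI.
  by exists n => //; split => //; rewrite -nE expr2 mulfK.
have nzig : i g != 0 by rewrite fmorph_eq0.
pose A := i g / A1.
have nzA : A != 0 by rewrite mulf_neq0 ?invr_neq0.
have SAE : S A = ep * A.
  rewrite /A fmorph_div SA1 SA invfM mulrCA; congr (_ * _).
  by apply: (mulfI nzep); rewrite divff // -expr2.
have TAE : T A = de * A.
  rewrite /A fmorph_div TA1 TA invfM mulrCA; congr (_ * _).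
  by apply: (mulfI nzde); rewrite divff // -expr2.
have [Og OA] : I g by rewrite IE; apply: principal_id.
exists A; split => // x Ox Sx Tx.
have [y yE] : exists y, x * A1 = i y.
  apply: fixK; rewrite rmorphM /= ?Sx ?Tx ?SA1 ?TA1 mulrACA -expr2 ?ep2 ?de2 mul1r //.
have Iy : I y.
  split; last by rewrite -yE mulfK.
  by apply/(ringint_rmorph i); rewrite -yE; auto.
move: Iy; rewrite IE => /(principalP _ nzg) Oyg; exists (y / g) => //.
by rewrite /A fmorph_div -yE; field; apply/andP.
Qed.

(** Suppose y1 - S y1, y2 - T y2, y3 - S T y3 are all outside P. Summed over the group, (g y1 - S
    y1) (g y2 - T y2) (g y3 - S T y3) leaves only the term g = 1, while its expansion is an integral
    combination of traces, hence in P. *)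
Lemma inertia_of_trace P : prime_ideal P ->
    (forall x, O x -> P (x + S x + T x + S (T x))) ->
  [\/ forall x, O x -> P (S x - x), forall x, O x -> P (T x - x)
    | forall x, O x -> P (S (T x) - x)].
Proof.
move=> pP trP; apply: contrapT => H.
have ex (f : L -> L) : ~ (forall x, O x -> P (f x - x)) -> exists2 y, O y & ~ P (y - f y).
  move=> nf; apply: contrapT => nex; apply: nf => x Ox; apply: contrapT => nP.
  by apply: nex; exists x => // /(primeN pP); rewrite opprB.
have [y1 O1 n1] : exists2 y, O y & ~ P (y - S y) by apply: ex => ?; apply: H; apply: Or31.
have [y2 O2 n2] : exists2 y, O y & ~ P (y - T y) by apply: ex => ?; apply: H; apply: Or32.
have [y3 O3 n3] : exists2 y, O y & ~ P (y - S (T y)) by apply: (ex (S \o T)) => ?; apply: H; apply: Or33.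
have OST x : O x -> O (S (T x)) by auto.
have : P ((y1 - S y1) * (y2 - T y2) * (y3 - S (T y3))).
  pose tr x := x + S x + T x + S (T x).
  have -> : (y1 - S y1) * (y2 - T y2) * (y3 - S (T y3)) =
     tr (y1 * y2 * y3) + (- S y1) * tr (y2 * y3) + (- T y2) * tr (y1 * y3) + (- S (T y3)) * tr (y1 * y2)
     + (S y1 * T y2) * tr y3 + (S y1 * S (T y3)) * tr y2 + (T y2 * S (T y3)) * tr y1
     + (- (S y1 * T y2 * S (T y3))) * tr 1.
    by rewrite /tr !rmorphM !rmorph1; ring.
  by repeat (apply: (primeD pP); last (apply: (primeMl pP); [auto 10 | apply: trP; auto])); apply: trP; auto.
by do 2?[case/(primeM_or pP); auto].
Qed.

(** The traces of integers form an ideal of O_K containing 4, the trace of 1. If proper, it lies in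
    a prime p = (c) above 2; take P over p. As c is fixed by the group, [inertia_even] applies to
    it, and its valuation at P is the ramification index. *)
Lemma tame_trace1 : tame L ->
    (exists x, S x != x) -> (exists x, T x != x) -> (exists x, S (T x) != x) ->
  exists2 x, O x & x + S x + T x + S (T x) = 1.
Proof.
move=> tameL nS nT nST.
have scale (f : {rmorphism L -> L}) : (exists x, f x != x) -> exists2 x, O x & f x != x.
  move=> [x nx]; have [m m0 Om] := ext_scale_ringint x; exists (m%:R * x) => //.
  by rewrite rmorphM rmorph_nat (inj_eq (mulfI (nz m0))).
pose tr x := x + S x + T x + S (T x).
pose J := [set y : K | OK y /\ exists2 x, O x & tr x = i y].
have idJ : ideal J.
  split; [split|] => /=.
  - by split => //; exists 0; rewrite // /tr !rmorph0 !addr0.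
  - move=> y1 y2 [O1 [x1 Ox1 E1]] [O2 [x2 Ox2 E2]]; split; auto.
    by exists (x1 + x2); auto; rewrite rmorphD -E1 -E2 /tr !rmorphD; ring.
  - move=> a y Oa [Oy [x Ox E]]; split; auto.
    exists (i a * x); first by apply: ringintM => //; apply/ringint_rmorph.
    by rewrite rmorphM -E /tr !rmorphM /= !SA !TA !SA; ring.
  - by move=> y [].
have J4 : J 4%:R by split => //; exists 1; rewrite // /tr !rmorph1 rmorph_nat; ring.
case: (pselect (J 1)) => [[_ [x Ox E]]|nJ1]; first by exists x; rewrite // -[RHS](rmorph1 i).
exfalso.
have nz4 : 4%:R != 0 :> K by apply: numfield_nat_neq0.
have [p pp Jp] := ideal_sub_prime finK idJ J4 nz4 nJ1.
have [idp nzp _ _] := pp.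
have [c nzc pE] := ideal_principal ray_trivial idp nzp.
have pc : p c by rewrite pE; apply: principal_id.
have Oc := prime_int pp pc.
have Oic : O (i c) by apply/ringint_rmorph.
have nzic : i c != 0 by rewrite fmorph_eq0.
have [|P pP cP] := ideal_sub_prime finL (ideal_principal_int Oic) (principal_id _) nzic.
  move=> /(principalP _ nzic) O1; apply: (prime_n1 pp); rewrite pE; apply/principalP => //.
  by apply/(ringint_rmorph i); rewrite fmorph_div rmorph1.
have Pc : P (i c) by apply: cP; apply: principal_id.
have pP_sub y : p y -> P (i y).
  rewrite pE => -[u Ou <-]; rewrite rmorphM; apply: (primeMr pP) => //.
  by apply/ringint_rmorph.
have P2 : P 2%:R.
  rewrite -(rmorph_nat i); apply: pP_sub.
  have : p (2%:R * 2%:R) by rewrite -natrM; apply: Jp.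
  by case/(primeM_or pp); auto.
have below : prime_below P = p.
  apply/seteqP; split => y; rewrite /prime_below /= iE; last by move=> py; split; [apply: prime_int py | apply: pP_sub].
  move=> [Oy Py]; apply: contrapT => npy; have [u Ou pu] := prime_maximal finK pp Oy npy.
  apply: (prime_n1 pP); rewrite -(rmorph1 i) -(subrK (u * y) 1) rmorphD rmorphM.
  apply: (primeD pP); first exact: pP_sub.
  by apply: (primeMl pP) => //; apply/ringint_rmorph.
have [z [zP [l Pl nPm] nOz]] := prime_inverse finL pP.
suff main (f : {rmorphism L -> L}) : involutive f -> (forall x, O x -> P (f x - x)) ->
    f (i c) = i c -> (exists x, f x != x) -> False.
  have trP x : O x -> P (tr x).
    move=> Ox; have [y yE] : exists y : K, tr x = i y.
      by apply: fixK; rewrite /tr !rmorphD /=; [rewrite !SK | rewrite -!ST !TK]; ring.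
    rewrite yE; apply: pP_sub; apply: Jp; split; last by exists x.
    by apply/(ringint_rmorph i); rewrite -yE /tr; auto 10.
  case: (inertia_of_trace pP trP) => H.
  - by apply: (main S) => //; rewrite SA.
  - by apply: (main T) => //; rewrite TA.
  - apply: (main (S \o T : {rmorphism L -> L})) => //=; last by rewrite TA SA.
    by move=> x /=; rewrite -ST SK TK.
move=> fK fP fc nf.
have [e [dve Ie nIe]] := inertia_even finL pP P2 fK fP zP Pl nPm nOz Oic nzic fc (scale f nf).
have ram : ram_index P e.
  split; rewrite below.
    have [I0 ID IM] := idealX_submod pP e.
    move=> _ [n [a [m [pa Om ->]]]]; apply: (big_ind (idealX P e)) => // k _.
    have := pa k; rewrite pE => -[u Ou <-].
    have -> : (c * u) *: m k = (i u * m k) * i c.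
      by rewrite -[in LHS](mul1r (m k)) scalerAl iE rmorphM; ring.
    apply: IM => //.
    by apply: ringintM => //; apply/ringint_rmorph.
  move=> sub; apply: nIe; apply: sub; exists 1%N, (fun=> c), (fun=> 1); split => //.
  by rewrite big_ord1 iE.
by have := tameL P e 2%N pP ram isT P2; rewrite dve.
Qed.

(** With h = (1 + A) / 2 one has (1 - a) / 4 = h (1 - h). *)
Lemma half_square_mod4 (A : L) (a : K) : O ((1 + A) / 2%:R) -> A ^+ 2 = i a ->
  OK ((1 - a) / 4%:R).
Proof.
move=> Oh aE; apply/(ringint_rmorph i).
have -> : i ((1 - a) / 4%:R) = (1 + A) / 2%:R * (1 - (1 + A) / 2%:R).
  rewrite fmorph_div rmorphB rmorph1 rmorph_nat -aE.
  by field; rewrite !nz.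
auto.
Qed.

(** Write 4 x = 1 + tA A + tB B + tC C. Each half trace such as x + S x = (1 + tA A) / 2 is
    integral, so (tA A)^2 = 1 modulo 4 and tA is invertible modulo 4. Replacing tA, tB, tC by
    congruent units changes x by an integer, and the units are absorbed into A, B, C. *)
Lemma normal_basis_generator :
    (exists2 x, O x & x + S x + T x + S (T x) = 1) ->
    (exists x, x + S x - T x - S (T x) != 0) ->
    (exists x, x - S x + T x - S (T x) != 0) ->
    (exists x, x - S x - T x + S (T x) != 0) ->
  exists A B C : L, [/\ A != 0, B != 0 & C != 0] /\
    [/\ O ((1 + A + B + C) / 4%:R), S A = A /\ T A = - A, S B = - B /\ T B = B,
        S C = - C /\ T C = - C &
    [/\ forall x, O x -> S x = x -> T x = - x -> exists2 y : K, OK y & x = i y * A,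
        forall x, O x -> S x = - x -> T x = x -> exists2 y : K, OK y & x = i y * B &
        forall x, O x -> S x = - x -> T x = - x -> exists2 y : K, OK y & x = i y * C]].
Proof.
move=> [x Ox trx] [a0 nza0] [b0 nzb0] [c0 nzc0].
have e1 : (1 : L) ^+ 2 = 1 by rewrite expr1n.
have e2 : (-1 : L) ^+ 2 = 1 by rewrite sqrrN expr1n.
have [|| A [nzA OA SA' TA' genA]] := eigen_generator e1 e2 nza0.
- by rewrite !rmorphD !rmorphN /= SK SK; ring.
- by rewrite !rmorphD !rmorphN /= -!ST !TK; ring.
have [|| B [nzB OB SB TB genB]] := eigen_generator e2 e1 nzb0.
- by rewrite !rmorphD !rmorphN /= SK SK; ring.
- by rewrite !rmorphD !rmorphN /= -!ST !TK; ring.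
have [|| C [nzC OC SC TC genC]] := eigen_generator e2 e2 nzc0.
- by rewrite !rmorphD !rmorphN /= SK SK; ring.
- by rewrite !rmorphD !rmorphN /= -!ST !TK; ring.
have OSx := OS Ox; have OTx := OT Ox; have OSTx := OS OTx.
have [|||tA OtA EA] := genA (x + S x - T x - S (T x)); first by auto.
- by rewrite !rmorphD !rmorphN /= SK SK; ring.
- by rewrite !rmorphD !rmorphN /= -!ST !TK; ring.
have [|||tB OtB EB] := genB (x - S x + T x - S (T x)); first by auto.
- by rewrite !rmorphD !rmorphN /= SK SK; ring.
- by rewrite !rmorphD !rmorphN /= -!ST !TK; ring.
have [|||tC OtC EC] := genC (x - S x - T x + S (T x)); first by auto.
- by rewrite !rmorphD !rmorphN /= SK SK; ring.
- by rewrite !rmorphD !rmorphN /= -!ST !TK; ring.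
have n2 := @nz 2 isT; have n4 := @nz 4 isT.
have unit ep de A' tA' : ep ^+ 2 = 1 -> de ^+ 2 = 1 -> A' != 0 -> O A' -> S A' = ep * A' -> T A' = de * A' ->
    OK tA' -> O ((1 + i tA' * A') / 2%:R) ->
    exists u : K, [/\ u != 0, OK u, OK u^-1 & OK ((u - tA') / 4%:R)].
  move=> ep2 de2 nzA' OA' SA0 TA0 OtA' Oh.
  have [n nE] : exists n, A' ^+ 2 = i n.
    by apply: fixK; rewrite rmorphXn /= ?SA0 ?TA0 exprMn ?ep2 ?de2 mul1r.
  have On : OK n by apply/(ringint_rmorph i); rewrite -nE; auto.
  have := @half_square_mod4 (i tA' * A') (tA' ^+ 2 * n) Oh.
  rewrite exprMn nE -rmorphXn -rmorphM => /(_ erefl) Or.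
  apply: (@unit_mod4 _ ray_trivial tA' (tA' * n) _ OtA' _ Or); first by auto.
  by field; apply: numfield_nat_neq0.
have hA : (1 + i tA * A) / 2%:R = x + S x by apply: (mulIf n2); rewrite divfK // -EA -{1}trx; ring.
have hB : (1 + i tB * B) / 2%:R = x + T x by apply: (mulIf n2); rewrite divfK // -EB -{1}trx; ring.
have hC : (1 + i tC * C) / 2%:R = x + S (T x)
  by apply: (mulIf n2); rewrite divfK // -EC -{1}trx; ring.
have [|u [nzu Ou OVu Eu]] := unit _ _ A tA e1 e2 nzA OA SA' TA' OtA; first by rewrite hA; auto.
have [|v [nzv Ov OVv Ev]] := unit _ _ B tB e2 e1 nzB OB SB TB OtB; first by rewrite hB; auto.
have [|w [nzw Ow OVw Ew]] := unit _ _ C tC e2 e2 nzC OC SC TC OtC; first by rewrite hC; auto.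
have nzi y : y != 0 -> i y != 0 by rewrite fmorph_eq0.
exists (i u * A), (i v * B), (i w * C); split; first by rewrite !mulf_neq0 ?nzi.
split.
- have -> : (1 + i u * A + i v * B + i w * C) / 4%:R = x + i ((u - tA) / 4%:R) * A
    + i ((v - tB) / 4%:R) * B + i ((w - tC) / 4%:R) * C.
    rewrite !fmorph_div !rmorphB !rmorph_nat.
    have -> : x = (1 + i tA * A + i tB * B + i tC * C) / 4%:R.
      by apply: (mulIf n4); rewrite divfK // -EA -EB -EC -[X in _ = X + _ + _ + _]trx; ring.
    by field.
  have Oi y : OK y -> O (i y) by move=> Oy; apply/ringint_rmorph.
  by repeat apply: ringintD => //; apply: ringintM; auto.
- by rewrite !rmorphM /= SA TA SA' TA' mul1r mulN1r mulrN.
- by rewrite !rmorphM /= SA TA SB TB mul1r mulN1r mulrN.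
- by rewrite !rmorphM /= SA TA SC TC !mulN1r mulrN.
split.
- move=> y Oy Sy Ty; have [||r Or ->] := genA y Oy; rewrite ?mul1r ?mulN1r //.
  by exists (r / u); auto; rewrite fmorph_div mulrA divfK ?nzi.
- move=> y Oy Sy Ty; have [||r Or ->] := genB y Oy; rewrite ?mul1r ?mulN1r //.
  by exists (r / v); auto; rewrite fmorph_div mulrA divfK ?nzi.
- move=> y Oy Sy Ty; have [||r Or ->] := genC y Oy; rewrite ?mul1r ?mulN1r //.
  by exists (r / w); auto; rewrite fmorph_div mulrA divfK ?nzi.
Qed.

(** * The conjugates of (1 + A + B + C) / 4 as an integral basis *)

Section NormalBasis.
Variables A B C : L.
Hypotheses (nzA : A != 0) (nzB : B != 0) (nzC : C != 0).
Hypotheses (SAE : S A = A) (TAE : T A = - A) (SBE : S B = - B) (TBE : T B = B).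
Hypotheses (SCE : S C = - C) (TCE : T C = - C).
Local Notation al := ((1 + A + B + C) / 4%:R).

Let n4 : 4%:R != 0 :> L. Proof. exact: nz. Qed.
Let nK4 : 4%:R != 0 :> K. Proof. exact: numfield_nat_neq0. Qed.
Local Notation comb p q r w := (i p + i q * A + i r * B + i w * C).
Let iR := (rmorph_nat i, fmorphV i, rmorphM i, rmorphN i, rmorph1 i, rmorphD i).

Let Scomb p q r w : S (comb p q r w) = comb p q (- r) (- w).
Proof. by rewrite !(rmorphD S) !(rmorphM S) /= !SA SAE SBE SCE !(rmorphN i) !mulrN !mulNr. Qed.
Let Tcomb p q r w : T (comb p q r w) = comb p (- q) r (- w).
Proof. by rewrite !(rmorphD T) !(rmorphM T) /= !TA TAE TBE TCE !(rmorphN i) !mulrN !mulNr. Qed.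
Let alE : al = comb 4%:R^-1 4%:R^-1 4%:R^-1 4%:R^-1.
Proof. by rewrite !iR; field. Qed.
Let Sal : S al = (1 + A - B - C) / 4%:R.
Proof. by rewrite alE Scomb !iR; field. Qed.
Let Tal : T al = (1 - A + B - C) / 4%:R.
Proof. by rewrite alE Tcomb !iR; field. Qed.
Let TSal : T (S al) = (1 - A - B + C) / 4%:R.
Proof. by rewrite alE Scomb Tcomb opprK !iR; field. Qed.

(** The numbers p, q, r, w are the values of the four characters at the coefficient vector. Signed
    sums of the conjugates of the relation isolate 4 times each eigencomponent. *)
Lemma normal_basis_free (r1 rS rT rU : K) :
  i r1 * al + i rS * S al + i rT * T al + i rU * T (S al) = 0 ->
  [/\ r1 = 0, rS = 0, rT = 0 & rU = 0].
Proof.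
rewrite TSal Sal Tal => y0.
pose p := r1 + rS + rT + rU; pose q := r1 + rS - rT - rU.
pose r := r1 - rS + rT - rU; pose w := r1 - rS - rT + rU.
have {}y0 : comb p q r w = 0.
  by rewrite -(mulr0 4%:R) -y0 /p /q /r /w !iR; field.
have [E1 E2 E3] : [/\ S (comb p q r w) = 0, T (comb p q r w) = 0 & T (S (comb p q r w)) = 0].
  by rewrite y0 !rmorph0.
rewrite Scomb in E1; rewrite Tcomb in E2; rewrite Scomb Tcomb opprK in E3.
have inj X u : X != 0 -> 4%:R * (i u * X) = 0 -> u = 0.
  by move=> nX /eqP; rewrite !mulf_eq0 (negPf n4) (negPf nX) orbF fmorph_eq0 => /eqP.
have p0 : p = 0.
  apply: (inj 1); first exact: oner_neq0.
  by rewrite -[RHS](addr0 0) -{1}y0 -[X in _ + X](addr0 0) -{1}E1 -[X in _ + (_ + X)](addr0 0) -{1}E2 -E3 !iR; ring.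
have q0 : q = 0.
  apply: (inj A _ nzA).
  by rewrite -[RHS](addr0 0) -{1}y0 -[X in _ + X](subr0 0) -{1}E1 -[X in _ + (_ - X)](addr0 0) -{1}E2 -E3 !iR; ring.
have r0 : r = 0.
  apply: (inj B _ nzB).
  by rewrite -[RHS](addr0 0) -{1}y0 -[X in _ + X](subr0 0) -{1}E2 -[X in _ + (_ - X)](addr0 0) -{1}E1 -E3 !iR; ring.
have w0 : w = 0.
  apply: (inj C _ nzC).
  by rewrite -[RHS](addr0 0) -{1}y0 -[X in _ + X](subr0 0) -{1}E3 -[X in _ + (_ - X)](addr0 0) -{1}E1 -E2 !iR; ring.
split; apply: (mulIf nK4); rewrite mul0r.
- by transitivity (p + q + r + w); [rewrite /p /q /r /w; ring | rewrite p0 q0 r0 w0 !addr0].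
- by transitivity (p + q - r - w); [rewrite /p /q /r /w; ring | rewrite p0 q0 r0 w0 !subr0 addr0].
- by transitivity (p - q + r - w); [rewrite /p /q /r /w; ring | rewrite p0 q0 r0 w0 !subr0 addr0].
- by transitivity (p - q - r + w); [rewrite /p /q /r /w; ring | rewrite p0 q0 r0 w0 !subr0 addr0].
Qed.

Hypothesis Oal : O al.
Hypothesis genA : forall x, O x -> S x = x -> T x = - x -> exists2 y : K, OK y & x = i y * A.
Hypothesis genB : forall x, O x -> S x = - x -> T x = x -> exists2 y : K, OK y & x = i y * B.
Hypothesis genC : forall x, O x -> S x = - x -> T x = - x -> exists2 y : K, OK y & x = i y * C.

(** The coefficient of x at a conjugate of [al] is, up to the factor a b c, the trace of x times the
    same conjugate of the dual element [be]. *)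
Lemma normal_basis_span x : O x -> exists r1 rS rT rU : K,
  [/\ OK r1, OK rS, OK rT & OK rU] /\
  x = i r1 * al + i rS * S al + i rT * T al + i rU * T (S al).
Proof.
move=> Ox.
have OSx := OS Ox; have OTx := OT Ox; have OSTx := OS OTx.
have OSa := OS Oal; have OTa := OT Oal; have OTSa := OT OSa.
have n2 := @nz 2 isT.
have [a aE] : exists a, A ^+ 2 = i a.
  by apply: fixK; rewrite rmorphXn /= ?SAE ?TAE ?sqrrN.
have [b bE] : exists b, B ^+ 2 = i b.
  by apply: fixK; rewrite rmorphXn /= ?SBE ?TBE ?sqrrN.
have [c cE] : exists c, C ^+ 2 = i c.
  by apply: fixK; rewrite rmorphXn /= ?SCE ?TCE ?sqrrN.
have Oa : OK ((1 - a) / 4%:R).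
  apply: half_square_mod4 aE; have -> : (1 + A) / 2%:R = al + S al by rewrite Sal; field; rewrite n2 n4.
  exact: ringintD.
have Ob : OK ((1 - b) / 4%:R).
  apply: half_square_mod4 bE; have -> : (1 + B) / 2%:R = al + T al by rewrite Tal; field; rewrite n2 n4.
  exact: ringintD.
have Oc : OK ((1 - c) / 4%:R).
  apply: half_square_mod4 cE; have -> : (1 + C) / 2%:R = al + T (S al) by rewrite TSal; field; rewrite n2 n4.
  exact: ringintD.
have mod4 u v : OK ((1 - u) / 4%:R) -> OK ((1 - v) / 4%:R) -> OK ((1 - u * v) / 4%:R).
  move=> Hu Hv; have -> : (1 - u * v) / 4%:R = (1 - u) / 4%:R + (1 - v) / 4%:R - 4%:R * ((1 - u) / 4%:R) * ((1 - v) / 4%:R) by field.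
  by auto 6.
have Oi y : OK y -> O (i y) by move=> Oy; apply/ringint_rmorph.
have OA : O A.
  have -> : A = 2%:R * (al + S al) - 1 by rewrite Sal; field; rewrite n4.
  by auto 6.
have OB : O B.
  have -> : B = 2%:R * (al + T al) - 1 by rewrite Tal; field; rewrite n4.
  by auto 6.
have OC : O C.
  have -> : C = 2%:R * (al + T (S al)) - 1 by rewrite TSal; field; rewrite n4.
  by auto 6.
(* be is dual to al for the trace form, up to the factor a b c = 1 mod 4. *)
pose be := (i (a * b * c) + i (b * c) * A + i (a * c) * B + i (a * b) * C) / 4%:R.
have Obe : O be.
  have -> : be = al - i ((1 - a * b * c) / 4%:R) - i ((1 - b * c) / 4%:R) * A
     - i ((1 - a * c) / 4%:R) * B - i ((1 - a * b) / 4%:R) * C.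
    rewrite /be !fmorph_div !(rmorphB i) !rmorph1 !rmorph_nat.
    by move: (i (a * b * c)) (i (b * c)) (i (a * c)) (i (a * b)) => q1 q2 q3 q4; field.
  by repeat (apply: ringintB); auto.
have [t1 t1E] : exists t1, x + S x + T x + S (T x) = i t1.
  by apply: fixK; rewrite !rmorphD /=; [rewrite !SK | rewrite -!ST !TK]; ring.
have Ot1 : OK t1 by apply/(ringint_rmorph i); rewrite -t1E; auto 6.
have [|||tA OtA EA] := genA (x := x + S x - T x - S (T x)); first by auto.
- by rewrite !rmorphD !rmorphN /= SK SK; ring.
- by rewrite !rmorphD !rmorphN /= -!ST !TK; ring.
have [|||tB OtB EB] := genB (x := x - S x + T x - S (T x)); first by auto.
- by rewrite !rmorphD !rmorphN /= SK SK; ring.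
- by rewrite !rmorphD !rmorphN /= -!ST !TK; ring.
have [|||tC OtC EC] := genC (x := x - S x - T x + S (T x)); first by auto.
- by rewrite !rmorphD !rmorphN /= SK SK; ring.
- by rewrite !rmorphD !rmorphN /= -!ST !TK; ring.
have xE : x = comb (t1 / 4%:R) (tA / 4%:R) (tB / 4%:R) (tC / 4%:R).
  by apply: (mulIf n4); rewrite !iR; transitivity (i t1 + i tA * A + i tB * B + i tC * C);
    [rewrite -t1E -EA -EB -EC; ring | field].
have beE : be = comb (a * b * c / 4%:R) (b * c / 4%:R) (a * c / 4%:R) (a * b / 4%:R).
  by rewrite /be !iR; field.
have calc (be' : L) (eA eB eC : K) :
    be' = comb (a * b * c / 4%:R) (eA * (b * c / 4%:R)) (eB * (a * c / 4%:R)) (eC * (a * b / 4%:R)) ->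
   x * be' + S (x * be') + T (x * be') + T (S (x * be')) =
    i (a * b * c * ((t1 + eA * tA + eB * tB + eC * tC) / 4%:R)).
  move=> ->; rewrite xE !(rmorphM S) !(rmorphM T) /= !Scomb !Tcomb !iR -aE -bE -cE.
  by field.
have key (eA eB eC : K) be' : OK eA -> OK eB -> OK eC -> O be' ->
    be' = comb (a * b * c / 4%:R) (eA * (b * c / 4%:R)) (eB * (a * c / 4%:R)) (eC * (a * b / 4%:R)) ->
    OK ((t1 + eA * tA + eB * tB + eC * tC) / 4%:R).
  move=> OeA OeB OeC Obe' /calc E; set r := (_ / _) in E *.
  have ON : OK (a * b * c * r).
    by apply/(ringint_rmorph i); rewrite -E; have := ringintM Ox Obe'; auto 8.
  have O4 : OK (4%:R * r) by rewrite /r mulrC divfK //; auto 8.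
  (* Both a b c r and 4 r are integral, and a b c = 1 modulo 4. *)
  have -> : r = a * b * c * r + (1 - a * b * c) / 4%:R * (4%:R * r) by field.
  by apply: ringintD => //; apply: ringintM => //; auto.
have O1 : OK 1 by []; have ON1 : OK (-1) by auto.
exists ((t1 + 1 * tA + 1 * tB + 1 * tC) / 4%:R), ((t1 + 1 * tA + (-1) * tB + (-1) * tC) / 4%:R),
  ((t1 + (-1) * tA + 1 * tB + (-1) * tC) / 4%:R), ((t1 + (-1) * tA + (-1) * tB + 1 * tC) / 4%:R); split.
  split.
  - by apply: (key _ _ _ be) => //; rewrite beE !mul1r.
  - by apply: (key _ _ _ (S be)); auto; rewrite beE Scomb !mul1r !mulN1r.
  - by apply: (key _ _ _ (T be)); auto; rewrite beE Tcomb !mul1r !mulN1r.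
  - by apply: (key _ _ _ (T (S be))); auto; rewrite beE Scomb Tcomb opprK !mul1r !mulN1r.
rewrite TSal Sal Tal {1}xE !iR.
by field.
Qed.

End NormalBasis.

End TameKlein.

Lemma tame_klein_normal_basis (K : fieldExtType rat) :
  ray_class_group_trivial (principal (4%:R : K)) -> hilbert_speiser K C2xC2.
Proof.
move=> ray L [galL isoL] tameL.
have [s [t [U inU ss tt st]]] := klein_group_elements (@mem_gal1 K L) isoL.
pose S : {rmorphism L -> L} := s; pose T : {rmorphism L -> L} := t.
have SK : involutive S by move=> x; have := galM s s (memvf x); rewrite ss gal_id => E; exact: esym E.
have TK : involutive T by move=> x; have := galM t t (memvf x); rewrite tt gal_id => E; exact: esym E.
have ST x : S (T x) = T (S x).
  by have := galM s t (memvf x); rewrite st galM ?memvf // => E; exact: E.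
have iE (y : K) : y%:A = in_alg L y by [].
have SA y : S (in_alg L y) = in_alg L y by rewrite -[LHS]/(s y%:A) linearZ /= rmorph1.
have TA y : T (in_alg L y) = in_alg L y by rewrite -[LHS]/(t y%:A) linearZ /= rmorph1.
have fixK x : S x = x -> T x = x -> exists y : K, x = in_alg L y.
  exact: (klein_fixed inU galL).
have [[n1 n2 n3] [n4 n5 n6]] := klein_neq U.
(* Linear independence of automorphisms; with signs for e1, e2, e3 it makes the three nontrivial
   eigenspaces nonzero. *)
have indep (e1 e2 e3 : L) : exists x, x + e1 * S x + e2 * T x + e3 * S (T x) != 0.
  pose cf (g : gal_of {:L}) : L := if g == 1%g then 1 else if g == s then e1 else if g == t then e2 else e3.
  have [|x _] := @gal_independent_contra _ _ {:L} (fun g => g \in 'Gal({:L} / 1)%g) cf 1%g (mem_gal1 _).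
    by rewrite /cf eqxx oner_neq0.
  rewrite (klein_sum U inU (fun g => cf g * g x)) => H; exists x; move: H.
  rewrite /cf !eqxx (negPf n1) (negPf n2) (negPf n3) (negPf n4) (negPf n5) (negPf n6).
  by rewrite gal_id mul1r galM ?memvf // ST.
have nontriv (g : gal_of {:L}) : g != 1%g -> exists x, g x != x.
  move=> ng; apply: contrapT => nex; move: ng; apply/negP; rewrite negbK.
  apply/gal_eqP => x _; rewrite gal_id; apply: contrapT => /eqP nx.
  by apply: nex; exists x.
have tr1 : exists2 x, ringint x & x + S x + T x + S (T x) = 1.
  apply: (tame_trace1 SK TK ST iE SA TA fixK ray tameL); try exact: nontriv.
  by have [x] := nontriv _ n3; rewrite galM ?memvf // => nx; exists x; rewrite ST.
have exA : exists x, x + S x - T x - S (T x) != 0.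
  by have [x Hx] := indep 1 (-1) (-1); exists x; move: Hx; rewrite !mulN1r mul1r.
have exB : exists x, x - S x + T x - S (T x) != 0.
  by have [x Hx] := indep (-1) 1 (-1); exists x; move: Hx; rewrite !mulN1r mul1r.
have exC : exists x, x - S x - T x + S (T x) != 0.
  by have [x Hx] := indep (-1) (-1) 1; exists x; move: Hx; rewrite !mulN1r mul1r.
have [A [B [C [[nzA nzB nzC] [Oal [SAE TAE] [SBE TBE] [SCE TCE] [genA genB genC]]]]]] :=
  normal_basis_generator SK TK ST SA TA fixK ray tr1 exA exB exC.
exists 1%N, (fun=> (1 + A + B + C) / 4%:R); split => [_|y Oy|a _] //.
  have [r1 [rS [rT [rU [[O1 OS OT OU] yE]]]]] :=
    normal_basis_span SK TK ST SA TA fixK SAE TAE SBE TBE SCE TCE Oal genA genB genC Oy.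
  exists (fun=> [ffun g => if g == 1%g then r1 else if g == s then rS else if g == t then rT else rU] : group_ring L).
  split; first by move=> _ g; rewrite ffunE; do !case: ifP => _.
  rewrite /= big_ord1 (klein_act U inU) !ffunE !eqxx.
  rewrite (negPf n1) (negPf n2) (negPf n3) (negPf n4) (negPf n5) (negPf n6).
  by rewrite {1}yE subrr.
rewrite /= big_ord1 (klein_act U inU) => a0 k.
have [E1 ES ET EU] := normal_basis_free SA TA nzA nzB nzC SAE TAE SBE TBE SCE TCE a0.
have -> : k = ord0 by apply: val_inj; case: k => -[].
by apply/ffunP => g; rewrite ffunE; have := inU g; rewrite !inE => /or4P[] /eqP ->.
Qed.

(** * A wild extension *)

(* L = K(A, B) with A^2 = 1 + pi^(2 e - 3) and B^2 = pi, where e = j + 2 is the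
   ramification index of p over 2. The elements 1, al, de, et below form a
   basis of O_L locally at p. *)
Section WildKlein.
Variables (K : fieldExtType rat) (L : fieldType) (i : {rmorphism K -> L}).
Variables (S T : {rmorphism L -> L}) (A B : L) (pi w : K) (j : nat).
Local Notation OK := (@ringint K).
Local Notation O := (@ringint L).
Local Notation p := (principal pi).
Hypotheses (nzpi : pi != 0) (primep : prime_ideal p) (Ow : OK w) (npw : ~ p w).
Hypothesis two_pi : 2%:R = pi ^+ (j + 2) * w.
Hypotheses (SA : forall y, S (i y) = i y) (TA : forall y, T (i y) = i y).
Hypotheses (A2 : A ^+ 2 = i (1 + pi ^+ (2 * j).+1)) (B2 : B ^+ 2 = i pi).
Hypotheses (SAE : S A = - A) (SBE : S B = B) (TAE : T A = A) (TBE : T B = - B).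
Hypothesis spanL : forall x : L, exists y0 y1 y2 y3 : K,
  x = i y0 + i y1 * A + i y2 * B + i y3 * (A * B).

Let finK := numfield_finite_quotients K.
Let p' := i pi.
Let w' := i w.
Let q := p' ^+ j.
Let nzp' : p' != 0. Proof. by rewrite fmorph_eq0. Qed.
Let nzq : q != 0. Proof. by rewrite expf_neq0. Qed.
Let Opi : OK pi. Proof. by apply: (prime_int primep); apply: principal_id. Qed.
Let Oi y : OK y -> O (i y). Proof. by move=> Oy; apply/ringint_rmorph. Qed.
Let Op' : O p'. Proof. exact: Oi. Qed.
Let Ow' : O w'. Proof. exact: Oi. Qed.
Let Oq : O q. Proof. by apply: ringintX. Qed.
Let OS x : O x -> O (S x). Proof. by move=> Ox; apply/ringint_rmorph. Qed.
Let OT x : O x -> O (T x). Proof. by move=> Ox; apply/ringint_rmorph. Qed.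
Let pE y : p y <-> OK (y / pi). Proof. exact: principalP. Qed.
Let two : 2%:R = q * p' ^+ 2 * w'.
Proof. by rewrite /q /p' /w' -!rmorphXn -!rmorphM -exprD -two_pi rmorph_nat. Qed.

(** Expanding (1 + q al)^2 = 1 + q^2 pi with 2 = q pi^2 w gives al^2 + pi^2 w al = pi. Then (al - B)
    (al + B) = - pi^2 w al, so [de] has relative norm - w al under T and is integral. If pi has
    valuation 1, then [al], [de], [al * de] have valuations 1/2, 1/4, 3/4. The unit [et] replaces
    [al * de] in the basis because T merely negates it. *)
Let al := (A - 1) / q.
Let de := (al - B) / p'.
Let et := al * B / p'.

Let AE : A = 1 + q * al. Proof. by rewrite /al mulrC divfK // addrC subrK. Qed.
Let BE : B = al - p' * de. Proof. by rewrite /de mulrC divfK // opprB addrC subrK. Qed.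

Let al2 : al ^+ 2 = p' - p' ^+ 2 * w' * al.
Proof.
apply: (mulfI (expf_neq0 2 nzq)).
have E : (1 + q * al) ^+ 2 = 1 + q ^+ 2 * p'.
  rewrite -AE A2 rmorphD rmorph1 rmorphXn exprS /q -exprM mulnC mulrC.
  by [].
have -> : q ^+ 2 * al ^+ 2 = (1 + q * al) ^+ 2 - 1 - 2%:R * (q * al) by ring.
by rewrite E two; ring.
Qed.

Let Sal : S al = - al - p' ^+ 2 * w'.
Proof.
rewrite {1}/al fmorph_div rmorphB rmorph1 SAE /q rmorphXn /= SA -/p' -/q.
apply: (mulIf nzq); rewrite divfK // AE.
have -> : - (1 + q * al) - 1 = - (q * al) - 2%:R by ring.
by rewrite two; ring.
Qed.

Let Tal : T al = al.
Proof. by rewrite /al fmorph_div rmorphB rmorph1 TAE /q rmorphXn /= TA. Qed.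

Let Tde : T de = de + q * p' * w' * B.
Proof.
rewrite {1}/de fmorph_div rmorphB Tal TBE /= TA -/p' opprK.
apply: (mulIf nzp'); rewrite divfK // {1}BE.
have -> : al + (al - p' * de) = p' * de + 2%:R * (al - p' * de) by ring.
by rewrite -BE two; ring.
Qed.

Let Tet : T et = et - q * p' ^+ 2 * w' * et.
Proof.
rewrite {1}/et fmorph_div rmorphM Tal TBE /= TA -/p' -two -/et mulrN mulNr -/et; ring.
Qed.

Let Set_ : S et = et - p' * w' * B - q * p' ^+ 2 * w' * et.
Proof.
rewrite {1}/et fmorph_div rmorphM Sal SBE /= SA -/p' -two /et; field.
exact: nzp'.
Qed.

Let de2 : de ^+ 2 = q * p' * w' * (al * de) + w' * al.
Proof.
have E : de * T de = - w' * al.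
  rewrite {1}/de fmorph_div rmorphB Tal TBE /= TA -/p' /de.
  have -> : (al - B) / p' * ((al - - B) / p') = (al ^+ 2 - B ^+ 2) / p' ^+ 2 by field.
  by rewrite al2 B2 -/p'; field.
have Tde' : T de = q * p' * w' * al - de.
  rewrite {1}/de fmorph_div rmorphB Tal TBE /= TA -/p'.
  apply: (mulIf nzp'); rewrite divfK // {1}BE.
  have -> : al - - (al - p' * de) = 2%:R * al - p' * de by ring.
  by rewrite two; ring.
have -> : de ^+ 2 = q * p' * w' * (al * de) - de * T de by rewrite Tde'; ring.
by rewrite E; ring.
Qed.

Let alde : al * de = 1 - p' * w' * al - et.
Proof.
apply: (mulfI nzp'); have -> : p' * (al * de) = al ^+ 2 - al * (al - p' * de) by ring.
by rewrite al2 -BE /et; field; apply: nzp'.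
Qed.

Let Oal : O al.
Proof.
apply: (@ringint_quadratic _ _ (p' ^+ 2 * w') (- p')); auto.
by rewrite al2; ring.
Qed.

Let Ode : O de.
Proof.
apply: (@ringint_quadratic _ _ (- (q * p' * w' * al)) (- (w' * al))); auto 6.
by rewrite de2; ring.
Qed.

Let Oet : O et.
Proof. by have -> : et = 1 - p' * w' * al - al * de by [rewrite alde; ring]; auto 8. Qed.

Let OB : O B. Proof. by rewrite BE; auto. Qed.

Let al2p : O (al ^+ 2 / p').
Proof.
have -> : al ^+ 2 / p' = 1 - p' * w' * al by rewrite al2; field; apply: nzp'.
by auto.
Qed.

(** The norm of this element to K is - w^2 / pi, which is not integral. *)
Let alde_p : ~ O (al * de / p').
Proof.
set x := _ / _ => Ox; have O1 : O (x * T x * S (x * T x)) by auto 6.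
have TE : x * T x = - w' * al ^+ 3 / p' ^+ 2.
  rewrite /x fmorph_div rmorphM Tal /= TA -/p' Tde.
  have -> : al * de / p' * (al * (de + q * p' * w' * B) / p') =
     al ^+ 2 * (de ^+ 2 + q * p' * w' * (B * de)) / p' ^+ 2 by field; apply: nzp'.
  have -> : de ^+ 2 + q * p' * w' * (B * de) = - w' * al; last by field; apply: nzp'.
  have -> : B * de = al * de - p' * de ^+ 2 by rewrite {1}BE; ring.
  have -> : de ^+ 2 + q * p' * w' * (al * de - p' * de ^+ 2) =
     de ^+ 2 - 2%:R * de ^+ 2 + q * p' * w' * (al * de) by rewrite two; ring.
  have -> : de ^+ 2 - 2%:R * de ^+ 2 = - de ^+ 2 by ring.
  by rewrite de2; ring.
have alS : al * S al = - p'.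
  have -> : al * S al = - al ^+ 2 - p' ^+ 2 * w' * al by rewrite Sal; ring.
  by rewrite al2; ring.
move: O1; rewrite TE fmorph_div rmorphM rmorphN !rmorphXn /= !SA -/p' -/w'.
have -> : - w' * al ^+ 3 / p' ^+ 2 * (- w' * S al ^+ 3 / p' ^+ 2) =
   w' ^+ 2 * (al * S al) ^+ 3 / p' ^+ 4 by field; apply: nzp'.
rewrite alS => O1.
have : O (i (w ^+ 2 / pi)).
  rewrite fmorph_div rmorphXn -/w' -/p'.
  have -> : w' ^+ 2 / p' = - (w' ^+ 2 * (- p') ^+ 3 / p' ^+ 4) by field; apply: nzp'.
  exact: ringintN.
move/(ringint_rmorph i)/pE/(prime_X primep Ow); exact: npw.
Qed.

Let coprime_pow s n : OK s -> ~ p s -> exists u v, [/\ OK u, OK v & s * u + pi ^+ n * v = 1].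
Proof.
move=> Os nps; have [u1 Ou1 [v1 Ov1 E1]] := prime_maximal finK primep Os nps.
elim: n => [|n [u [v [Ou Ov E]]]].
  by exists 0, 1; split => //; rewrite mulr0 add0r expr0 mulr1.
exists (s * u * u1 + pi ^+ n * v * u1 + s * u * 0 + u * (pi * v1)), (v * v1); split; auto 8.
rewrite -[RHS]mulr1 -{1}E; have -> : (1 : K) = s * u1 + pi * v1 by rewrite E1; ring.
by rewrite exprS; ring.
Qed.

(** Since s and pi^n generate the unit ideal, integrality need only be checked at p when the
    denominator is a power of pi. *)
Let local_integral s n x : OK s -> ~ p s -> O (i s * x) -> O (p' ^+ n * x) -> O x.
Proof.
move=> Os nps Osx Opx; have [u [v [Ou Ov E]]] := coprime_pow n Os nps.
have -> : x = i u * (i s * x) + i v * (p' ^+ n * x).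
  transitivity (i (s * u + pi ^+ n * v) * x); first by rewrite E rmorph1 mul1r.
  by rewrite rmorphD !rmorphM rmorphXn -/p'; ring.
by auto.
Qed.

Let nondiv r : OK r -> O (i r * (al * de / p')) -> p r.
Proof.
move=> Or H; apply: contrapT => npr; apply: alde_p.
apply: (@local_integral r 1) => //; rewrite expr1 mulrC divfK //; exact: ringintM.
Qed.

(** After [et] is expressed through [al * de], the four terms have the distinct valuations 0, 1/2,
    1/4, 3/4. Multiplying by [al * de], [al], [de] and 1 in turn brings the lowest remaining term to
    valuation 3/4 and the others to at least 1, so that [nondiv] applies. *)
Lemma independent_mod_p r0 r1 r2 r3 : OK r0 -> OK r1 -> OK r2 -> OK r3 ->
  O ((i r0 + i r1 * al + i r2 * de + i r3 * et) / p') -> [/\ p r0, p r1, p r2 & p r3].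
Proof.
move=> O0 O1 O2 O3 OX.
have [I0 I1 I2 I3] := And4 (Oi O0) (Oi O1) (Oi O2) (Oi O3).
have alde2 : O (al * de ^+ 2 / p').
  have -> : al * de ^+ 2 / p' = al ^+ 2 / p' * (q * p' * w' * de + w') by rewrite de2; field; apply: nzp'.
  by auto 7.
have {OX} OX : O ((i (r0 + r3) + i r1 * al + i r2 * de - i r3 * (al * de)) / p').
  have -> : (i (r0 + r3) + i r1 * al + i r2 * de - i r3 * (al * de)) / p' =
    (i r0 + i r1 * al + i r2 * de + i r3 * et) / p' + i r3 * (w' * al).
    by rewrite alde rmorphD; field; apply: nzp'.
  by auto 6.
have E0 : p (r0 + r3).
  apply: nondiv; first by auto.
  have -> : i (r0 + r3) * (al * de / p') =
    (i (r0 + r3) + i r1 * al + i r2 * de - i r3 * (al * de)) / p' * (al * de)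
    - i r1 * (al ^+ 2 / p') * de - i r2 * (al * de ^+ 2 / p') + i r3 * (al ^+ 2 / p') * de ^+ 2.
    by field; apply: nzp'.
  by auto 9.
have {OX} OX : O ((i r1 * al + i r2 * de - i r3 * (al * de)) / p').
  have -> : (i r1 * al + i r2 * de - i r3 * (al * de)) / p' =
    (i (r0 + r3) + i r1 * al + i r2 * de - i r3 * (al * de)) / p' - i ((r0 + r3) / pi).
    by rewrite [i (_ / _)]fmorph_div -/p'; field; apply: nzp'.
  by apply: ringintB => //; apply: Oi; apply/pE.
have E2 : p r2.
  apply: nondiv => //.
  have -> : i r2 * (al * de / p') = (i r1 * al + i r2 * de - i r3 * (al * de)) / p' * al
     - i r1 * (al ^+ 2 / p') + i r3 * (al ^+ 2 / p') * de by field; apply: nzp'.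
  by auto 9.
have {OX} OX : O ((i r1 * al - i r3 * (al * de)) / p').
  have -> : (i r1 * al - i r3 * (al * de)) / p' =
    (i r1 * al + i r2 * de - i r3 * (al * de)) / p' - i (r2 / pi) * de.
    by rewrite [i (_ / _)]fmorph_div -/p'; field; apply: nzp'.
  by apply: ringintB => //; apply: ringintM => //; apply: Oi; apply/pE.
have E1 : p r1.
  apply: nondiv => //.
  have -> : i r1 * (al * de / p') = (i r1 * al - i r3 * (al * de)) / p' * de
     + i r3 * (al * de ^+ 2 / p') by field; apply: nzp'.
  by auto 9.
have E3 : p r3.
  apply: nondiv => //.
  have -> : i r3 * (al * de / p') = - ((i r1 * al - i r3 * (al * de)) / p')
     + i (r1 / pi) * al by rewrite [i (_ / _)]fmorph_div -/p'; field; apply: nzp'.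
  by apply: ringintD; [auto | apply: ringintM => //; apply: Oi; apply/pE].
by split => //; rewrite -(addrK r3 r0); apply: primeB.
Qed.

Lemma not_dvd_B r : OK r -> O (i r * B / p') -> p r.
Proof.
move=> Or H; have [] := @independent_mod_p 0 r 0 0; auto.
have -> : (i 0 + i r * al + i 0 * de + i 0 * et) / p' = i r * B / p' + i r * de.
  by rewrite rmorph0 {1}BE; field; apply: nzp'.
by auto.
Qed.

(** A common denominator d of the coordinates can be freed of pi: the factor s is d divided by the
    full power of pi in it. *)
Lemma local_basis x : O x -> exists s y0 y1 y2 y3, [/\ OK s, ~ p s &
  [/\ x = i y0 + i y1 * al + i y2 * de + i y3 * et, OK (s * y0), OK (s * y1), OK (s * y2) & OK (s * y3)]].
Proof.
move=> Ox.
have [y0 [y1 [y2 [y3 xE]]]] : exists y0 y1 y2 y3, x = i y0 + i y1 * al + i y2 * de + i y3 * et.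
  have [z0 [z1 [z2 [z3 ->]]]] := spanL x.
  exists (z0 + z1), (z1 * pi ^+ j + z2 + z3), (- (z2 + z3) * pi), (z3 * pi ^+ j * pi).
  have -> : A * B = B + q * p' * et by rewrite {1}AE /et; field; apply: nzp'.
  rewrite AE BE !(rmorphM, rmorphD, rmorphN, rmorphXn) /= -/p' -/q.
  by ring.
have [d [nzd Od D0 D1] [D2 D3]] : exists2 d, [/\ d != 0, OK d, OK (d * y0) & OK (d * y1)] & OK (d * y2) /\ OK (d * y3).
  have [m0 p0 O0] := numfield_scale_ringint y0; have [m1 p1 O1] := numfield_scale_ringint y1.
  have [m2 p2 O2] := numfield_scale_ringint y2; have [m3 p3 O3] := numfield_scale_ringint y3.
  exists (m0%:R * m1%:R * m2%:R * m3%:R).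
    split; first by rewrite !mulf_neq0 // numfield_nat_neq0.
    - by auto 6.
    - have -> : m0%:R * m1%:R * m2%:R * m3%:R * y0 = m0%:R * y0 * m1%:R * m2%:R * m3%:R by ring.
      by auto 6.
    - have -> : m0%:R * m1%:R * m2%:R * m3%:R * y1 = m1%:R * y1 * m0%:R * m2%:R * m3%:R by ring.
      by auto 6.
  split.
  - have -> : m0%:R * m1%:R * m2%:R * m3%:R * y2 = m2%:R * y2 * m0%:R * m1%:R * m3%:R by ring.
    by auto 6.
  - have -> : m0%:R * m1%:R * m2%:R * m3%:R * y3 = m3%:R * y3 * m0%:R * m1%:R * m2%:R by ring.
    by auto 6.
have ex : exists n, ~~ `[< OK (d / pi ^+ n) >].
  apply: contrapT => H; apply: (prime_n1 primep); apply/pE.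
  rewrite div1r; apply: (almost_integral finK nzd) => n.
  rewrite exprVn; apply: contrapT => nn; apply: H; exists n; exact/asboolPn.
case: (ex_minnP ex) => -[|m] /asboolPn nm minm; first by rewrite expr0 divr1 in nm.
have Om n : (n <= m)%N -> OK (d / pi ^+ n).
  by move=> nm'; apply/asboolP; apply: contrapT => /negP /minm; rewrite ltnNge nm'.
(* One factor pi is removed at a time: d x / pi^(n + 1) is integral, so independence modulo p makes
   pi divide all four coefficients. *)
have main n : (n <= m)%N -> [/\ OK (d / pi ^+ n * y0), OK (d / pi ^+ n * y1),
    OK (d / pi ^+ n * y2) & OK (d / pi ^+ n * y3)].
  elim: n => [|n IH] ln; first by rewrite expr0 divr1.
  have [H0 H1 H2 H3] := IH (ltnW ln).
  have [|E0 E1 E2 E3] := independent_mod_p H0 H1 H2 H3.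
    have -> : (i (d / pi ^+ n * y0) + i (d / pi ^+ n * y1) * al + i (d / pi ^+ n * y2) * de
         + i (d / pi ^+ n * y3) * et) / p' = i (d / pi ^+ n.+1) * x.
      rewrite xE !rmorphM !fmorphV !rmorphXn -/p' exprS; field.
      by rewrite nzp' expf_neq0.
    by apply: ringintM => //; apply: Oi; apply: Om.
  have E y : d / pi ^+ n.+1 * y = d / pi ^+ n * y / pi.
    by rewrite exprS; field; rewrite nzpi expf_neq0.
  by rewrite !E; split; apply/pE.
have [H0 H1 H2 H3] := main m (leqnn m).
exists (d / pi ^+ m), y0, y1, y2, y3; split => //; first exact: Om.
move/pE; have -> : d / pi ^+ m / pi = d / pi ^+ m.+1 by rewrite exprS; field; rewrite nzpi expf_neq0.
exact: nm.
Qed.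

(** With e = j + 2, the exponents e - 1 here and e + 1 in [wild_u] are the largest that keep the
    images of [de] and [et] respectively integral. *)
Definition wild_t x := (T x - x) / p' ^+ j.+1.
Definition wild_u x := (T (S x) - S x - T x + x) / p' ^+ (j + 3).

Let morph_comb (U : {rmorphism L -> L}) : (forall y, U (i y) = i y) -> forall y0 y1 y2 y3 a d e,
  U (i y0 + i y1 * a + i y2 * d + i y3 * e) = i y0 + i y1 * U a + i y2 * U d + i y3 * U e.
Proof. by move=> UA y0 y1 y2 y3 a d e; rewrite !rmorphD !rmorphM /= !UA. Qed.

Let wild_tE y0 y1 y2 y3 : wild_t (i y0 + i y1 * al + i y2 * de + i y3 * et) =
  i y2 * (w' * B) - i y3 * (p' * w' * et).
Proof.
rewrite /wild_t (morph_comb TA) Tal Tde Tet.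
have -> : p' ^+ j.+1 = q * p' by rewrite exprSr.
field.
by rewrite nzq nzp'.
Qed.

Let wild_uE y0 y1 y2 y3 : wild_u (i y0 + i y1 * al + i y2 * de + i y3 * et) =
  i y3 * (w' ^+ 2 * B + q * p' * w' ^+ 2 * et).
Proof.
rewrite /wild_u; have -> : p' ^+ (j + 3) = q * p' ^+ 3 by rewrite exprD.
set x := i y0 + i y1 * al + i y2 * de + i y3 * et.
have Sde : S de = de - q * p' * w' * al - p' * w'.
  rewrite {1}/de fmorph_div rmorphB Sal SBE /= SA -/p'.
  apply: (mulIf nzp'); rewrite divfK // {1}BE.
  have -> : - al - p' ^+ 2 * w' - (al - p' * de) = p' * de - 2%:R * al - p' ^+ 2 * w' by ring.
  by rewrite two; ring.
have Sal' : S al = al - q * p' ^+ 2 * w' * al - p' ^+ 2 * w' by rewrite Sal -two; ring.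
(* S x - x is brought to a combination with scalars from K, so that [morph_comb] can evaluate T on
   it. *)
have [v vE] : exists v, i v = - (i y1 * p' + i y2) * (p' * w').
  by exists (- (y1 * pi + y2) * (pi * w)); rewrite !(rmorphM, rmorphN, rmorphD).
have [v' vE'] : exists v', i v' = i v * q by exists (v * pi ^+ j); rewrite rmorphM rmorphXn.
have [c1 c1E] : exists c, i c = - i y3 * (p' * w').
  by exists (- y3 * (pi * w)); rewrite !(rmorphM, rmorphN).
have [c2 c2E] : exists c, i c = - i y3 * (q * p' ^+ 2 * w').
  by exists (- y3 * (pi ^+ j * pi ^+ 2 * w)); rewrite !(rmorphM, rmorphN, rmorphXn).
have -> : T (S x) - S x - T x + x = T (S x - x) - (S x - x) by rewrite rmorphB; ring.
have -> : S x - x = i v + i v' * al + i c1 * B + i c2 * et.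
  by rewrite /x (morph_comb SA) Sal' Sde Set_ vE' vE c1E c2E; ring.
rewrite (morph_comb TA) Tal TBE Tet.
have -> : i v + i v' * al + i c1 * - B + i c2 * (et - q * p' ^+ 2 * w' * et)
   - (i v + i v' * al + i c1 * B + i c2 * et) = - i c1 * (2%:R * B) - i c2 * (q * p' ^+ 2 * w' * et).
  by ring.
by rewrite two c1E c2E; field; rewrite nzq nzp'.
Qed.

Lemma wild_t_int x : O x -> O (wild_t x).
Proof.
move=> Ox; have [s [y0 [y1 [y2 [y3 [Os ns [xE O0 O1 O2 O3]]]]]]] := local_basis Ox.
apply: (@local_integral s j.+1) => //; last first.
  by rewrite /wild_t mulrC divfK ?expf_neq0 //; auto.
rewrite xE wild_tE.
have -> : i s * (i y2 * (w' * B) - i y3 * (p' * w' * et)) =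
   i (s * y2) * (w' * B) - i (s * y3) * (p' * w' * et) by rewrite !rmorphM; ring.
by auto 9.
Qed.

Lemma wild_u_int x : O x -> O (wild_u x).
Proof.
move=> Ox; have [s [y0 [y1 [y2 [y3 [Os ns [xE O0 O1 O2 O3]]]]]]] := local_basis Ox.
apply: (@local_integral s (j + 3)) => //; last first.
  by rewrite /wild_u mulrC divfK ?expf_neq0 //; auto 6.
rewrite xE wild_uE.
have -> : i s * (i y3 * (w' ^+ 2 * B + q * p' * w' ^+ 2 * et)) =
   i (s * y3) * (w' ^+ 2 * B + q * p' * w' ^+ 2 * et) by rewrite !rmorphM; ring.
by auto 9.
Qed.

(* Modulo p both operators map every integer to a multiple of B, while they are
   linearly independent modulo p: no b can be a free generator. *)
Lemma wild_not_free b : O b ->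
    (forall c1 c2, OK c1 -> OK c2 -> O ((i c1 * wild_t b + i c2 * wild_u b) / p') ->
       forall x, O x -> O ((i c1 * wild_t x + i c2 * wild_u x) / p')) -> False.
Proof.
move=> Ob H; have [s [y0 [y1 [y2 [y3 [Os ns [bE O0 O1 O2 O3]]]]]]] := local_basis Ob.
have tde : wild_t de = w' * B.
  have {1}-> : de = i 0 + i 0 * al + i 1 * de + i 0 * et by rewrite !rmorph0 rmorph1; ring.
  by rewrite wild_tE rmorph0 rmorph1; ring.
have ude : wild_u de = 0.
  have {1}-> : de = i 0 + i 0 * al + i 1 * de + i 0 * et by rewrite !rmorph0 rmorph1; ring.
  by rewrite wild_uE rmorph0; ring.
have tet : wild_t et = - (p' * w' * et).
  have {1}-> : et = i 0 + i 0 * al + i 0 * de + i 1 * et by rewrite !rmorph0 rmorph1; ring.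
  by rewrite wild_tE rmorph0 rmorph1; ring.
have uet : wild_u et = w' ^+ 2 * B + q * p' * w' ^+ 2 * et.
  have {1}-> : et = i 0 + i 0 * al + i 0 * de + i 1 * et by rewrite !rmorph0 rmorph1; ring.
  by rewrite wild_uE rmorph1; ring.
(* Evaluation at [de] gives c1 w B, and at [et] it gives c2 w^2 B up to multiples of pi; B is not
   divisible by p. *)
have {}H c1 c2 : OK c1 -> OK c2 -> O ((i c1 * wild_t b + i c2 * wild_u b) / p') -> p c1 /\ p c2.
  move=> Oc1 Oc2 /(H _ _ Oc1 Oc2) HH.
  have pc1 : p c1.
    have /(not_dvd_B (r := c1 * w)) : O (i (c1 * w) * B / p').
      have := HH _ Ode; rewrite tde ude mulr0 addr0 rmorphM; by rewrite mulrA.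
    by case/(_ (ringintM Oc1 Ow))/(primeM_or primep).
  split => //.
  have : p (c2 * w ^+ 2).
    apply: not_dvd_B; first by auto.
    have -> : i (c2 * w ^+ 2) * B / p' = (i c1 * wild_t et + i c2 * wild_u et) / p'
       + i c1 * (w' * et) - i c2 * (q * w' ^+ 2 * et).
      by rewrite tet uet rmorphM rmorphXn -/w'; field; apply: nzp'.
    have [I1 I2] := conj (Oi Oc1) (Oi Oc2).
    apply: ringintB; last by auto 6.
    by apply: ringintD; [apply: HH | auto].
  by case/(primeM_or primep) => //; auto; move/(prime_X primep Ow).
have [f2 f2E] : exists f2, s * y2 = f2 by exists (s * y2).
have [f3 f3E] : exists f3, s * y3 = f3 by exists (s * y3).
have sf2 : i s * i y2 = i f2 by rewrite -f2E rmorphM.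
have sf3 : i s * i y3 = i f3 by rewrite -f3E rmorphM.
rewrite f2E in O2; rewrite f3E in O3.
have [I2 I3] := conj (Oi O2) (Oi O3).
have bt : i s * wild_t b = i f2 * (w' * B) - i f3 * (p' * w' * et).
  by rewrite bE wild_tE -sf2 -sf3; ring.
have bu : i s * wild_u b = i f3 * (w' ^+ 2 * B + q * p' * w' ^+ 2 * et).
  by rewrite bE wild_uE -sf3; ring.
have nps c : OK c -> p (c * s) -> p c by move=> Oc /(primeM_or primep) [].
(* The coefficients are chosen to cancel the B terms: w f3 (f2 w B) - f2 (f3 w^2 B) = 0. The factor
   s clears denominators. *)
have [||| pf3 pf2] := H (w * f3 * s) (- f2 * s); auto.
  have -> : (i (w * f3 * s) * wild_t b + i (- f2 * s) * wild_u b) / p' =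
     - (i f3 ^+ 2 * w' ^+ 2 * et) - i f2 * i f3 * (q * w' ^+ 2 * et).
    rewrite !rmorphM rmorphN -/w'.
    have -> : w' * i f3 * i s * wild_t b + - i f2 * i s * wild_u b =
       w' * i f3 * (i s * wild_t b) - i f2 * (i s * wild_u b) by ring.
    by rewrite bt bu; field; apply: nzp'.
  by auto 9.
have {}pf3 : p f3.
  have : p (w * f3) by apply: nps => //; auto.
  by case/(primeM_or primep).
have {}pf2 : p f2.
  have : p (- f2) by apply: nps => //; auto.
  by move/(primeN primep); rewrite opprK.
(* With f2 and f3 in p, already [wild_t] alone sends s b into p, which forces s into p. *)
have [||| ps _] := H s 0; auto.
rewrite bt rmorph0 mul0r addr0.
have -> : (i f2 * (w' * B) - i f3 * (p' * w' * et)) / p' = i (f2 / pi) * (w' * B) - i f3 * (w' * et).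
  by rewrite fmorph_div -/p'; field; apply: nzp'.
apply: ringintB; last by auto.
by apply: ringintM; [apply: Oi; apply/pE | auto].
Qed.

End WildKlein.

(** * Biquadratic extensions *)

Section Biquadratic.
Variables (K : fieldType) (a b : K).
Hypothesis nz2 : 2%:R != 0 :> K.
Hypotheses (sqa : forall x, x ^+ 2 != a) (sqb : forall x, x ^+ 2 != b) (sqab : forall x, x ^+ 2 != a * b).

(** Its roots are the four sums of a square root of a and a square root of b. *)
Definition biquad_poly : {poly K} :=
  'X^4 + (- (2%:R * (a + b)) *: 'X^2 + ((a - b) ^+ 2)%:P).

Let coefp k : biquad_poly`_k = (k == 4%N)%:R - 2%:R * (a + b) * (k == 2%N)%:R + (if k == 0%N then (a - b) ^+ 2 else 0).
Proof. by rewrite /biquad_poly !(coefD, coefZ, coefXn, coefC) addrA mulNr. Qed.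

Lemma size_biquad_poly : size biquad_poly = 5%N.
Proof.
rewrite size_polyDl size_polyXn // (leq_ltn_trans (size_polyD _ _)) // gtn_max.
rewrite (leq_ltn_trans (size_scale_leq _ _)) ?size_polyXn //.
by rewrite (leq_ltn_trans (size_polyC_leq1 _)).
Qed.

(** A root x would make (x^2 - a - b) / 2 a square root of a b. *)
Let noroot x : ~~ root biquad_poly x.
Proof.
apply/negP => /rootP; rewrite !(hornerD, hornerZ, hornerXn, hornerC) => E.
have := sqab ((x ^+ 2 - (a + b)) / 2%:R); apply/negP; rewrite negbK.
apply/eqP; apply: (mulIf (expf_neq0 2 nz2)).
have -> : ((x ^+ 2 - (a + b)) / 2%:R) ^+ 2 * 2%:R ^+ 2 =
  (x ^+ 4 + (- (2%:R * (a + b)) * x ^+ 2 + (a - b) ^+ 2)) + a * b * 2%:R ^+ 2.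
  by field.
by rewrite E add0r.
Qed.

(** Made monic, the factors are X^2 + u X + v and X^2 - u X + w with u (w - v) = 0. If u = 0, then
    (v - w) / 4 is a square root of a b. If v = w, then v is a - b or b - a, and u / 2 is a square
    root of a or of b. *)
Let noquad (q r : {poly K}) : size q = 3%N -> size r = 3%N -> biquad_poly = q * r -> False.
Proof.
move=> sq sr E.
have q3 k : (3 <= k)%N -> q`_k = 0 by move=> lk; apply: nth_default; rewrite sq.
have r3 k : (3 <= k)%N -> r`_k = 0 by move=> lk; apply: nth_default; rewrite sr.
have C k : biquad_poly`_k = \sum_(j < k.+1) q`_j * r`_(k - j) by rewrite E coefM.
have C4 : q`_2 * r`_2 = 1.
  have := C 4%N; rewrite coefp /= !big_ord_recl big_ord0 /= /bump /= (q3 3%N) // (q3 4%N) // (r3 3%N) // (r3 4%N) //.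
  by rewrite !(mulr0, mul0r, oppr0, subr0, add0r, addr0) => H; exact: esym H.
have C3 : q`_1 * r`_2 + q`_2 * r`_1 = 0.
  have := C 3%N; rewrite coefp /= !big_ord_recl big_ord0 /= /bump /= (q3 3%N) // (r3 3%N) //.
  by rewrite !(mulr0, mul0r, oppr0, subr0, add0r, addr0) => H; exact: esym H.
have C2 : q`_0 * r`_2 + q`_1 * r`_1 + q`_2 * r`_0 = - (2%:R * (a + b)).
  have := C 2%N; rewrite coefp /= !big_ord_recl big_ord0 /= /bump /= .
  by rewrite !(mulr1, add0r, addr0) => H; rewrite -addrA; exact: esym H.
have C1 : q`_0 * r`_1 + q`_1 * r`_0 = 0.
  have := C 1%N; rewrite coefp /= !big_ord_recl big_ord0 /= /bump /= .
  by rewrite !(mulr0, oppr0, subr0, add0r, addr0) => H; exact: esym H.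
have C0 : q`_0 * r`_0 = (a - b) ^+ 2.
  have := C 0%N; rewrite coefp /= !big_ord_recl big_ord0 /= /bump /= .
  by rewrite !(mulr0, oppr0, subr0, add0r, addr0) => H; exact: esym H.
move: q`_0 q`_1 q`_2 r`_0 r`_1 r`_2 C4 C3 C2 C1 C0 => q0 q1 q2 r0 r1 r2 C4 C3 C2 C1 C0.
pose u := q1 * r2; pose v := q0 * r2; pose w := r0 * q2.
have r1E : r1 * q2 = - u by apply/eqP; rewrite -addr_eq0 /u addrC [r1 * _]mulrC C3.
have E2 : v + w - u ^+ 2 = - (2%:R * (a + b)).
  rewrite -C2 /v /w; have -> : q1 * r1 = - u ^+ 2; last by ring.
  transitivity ((q1 * r2) * (r1 * q2) * 1); last by rewrite r1E -/u; ring.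
  have -> : q1 * r1 = (q1 * r1) * (q2 * r2) by rewrite C4 mulr1.
  by ring.
have E1 : u * (w - v) = 0.
  have : (q0 * r1 + q1 * r0) * (q2 * r2) = 0 by rewrite C1 mul0r.
  have -> : (q0 * r1 + q1 * r0) * (q2 * r2) = (q0 * r2) * (r1 * q2) + (q1 * r2) * (r0 * q2) by ring.
  by rewrite r1E -/u -/v -/w => <-; ring.
have E0 : v * w = (a - b) ^+ 2.
  rewrite -C0 /v /w; have -> : q0 * r0 = q0 * r0 * (q2 * r2) by rewrite C4 mulr1.
  by ring.
have nz4 : 4%:R != 0 :> K by have -> : 4%:R = 2%:R * 2%:R :> K; [ring | rewrite mulf_neq0].
move/eqP: E1; rewrite mulf_eq0 => /orP[/eqP u0|].
  have := sqab ((v - w) / 4%:R); apply/negP; rewrite negbK; apply/eqP.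
  apply: (mulIf (expf_neq0 2 nz4)).
  have -> : ((v - w) / 4%:R) ^+ 2 * 4%:R ^+ 2 = (v + w - u ^+ 2) ^+ 2 - 4%:R * (v * w) by rewrite u0; field.
  by rewrite E2 E0; ring.
rewrite subr_eq0 => /eqP wv; rewrite wv in E2 E0.
have /eqP : (v - (a - b)) * (v + (a - b)) = 0.
  have -> : (v - (a - b)) * (v + (a - b)) = v * v - (a - b) ^+ 2 by ring.
  by rewrite E0 subrr.
have uE : u ^+ 2 = 2%:R * v + 2%:R * (a + b).
  have -> : u ^+ 2 = 2%:R * v - (v + v - u ^+ 2) by ring.
  by rewrite E2 opprK.
rewrite mulf_eq0 => /orP[]; rewrite ?subr_eq0 ?addr_eq0 => /eqP vE.
- have := sqa (u / 2%:R); apply/negP; rewrite negbK expr_div_n uE vE; apply/eqP.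
  by field.
- have := sqb (u / 2%:R); apply/negP; rewrite negbK expr_div_n uE vE; apply/eqP.
  by field.
Qed.

Lemma biquad_irreducible : irreducible_poly biquad_poly.
Proof.
split; rewrite ?size_biquad_poly // => q sq1 /dvdpP [r E].
have nzp : biquad_poly != 0 by rewrite -size_poly_eq0 size_biquad_poly.
have nzq : q != 0 by apply: contraNneq nzp => q0; rewrite E q0 mulr0.
have nzr : r != 0 by apply: contraNneq nzp => r0; rewrite E r0 mul0r.
have sE : (size r + size q)%N = 6%N.
  by have := size_biquad_poly; rewrite E size_mul //; case: (size r + size q)%N => //= n ->.
have sr0 : (0 < size r)%N by rewrite size_poly_gt0.
have sq0 : (0 < size q)%N by rewrite size_poly_gt0.
have lin (f : {poly K}) : size f = 2%N -> f %| biquad_poly -> False.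
  move=> sf df; have [x fx] := poly2_root sf.
  have := noroot x; apply/negP; rewrite negbK; move: fx.
  by rewrite -!dvdp_XsubCl => /dvdp_trans; apply.
have dq : q %| biquad_poly by rewrite E dvdp_mull.
have dr : r %| biquad_poly by rewrite E dvdp_mulr.
have [|||] : [\/ size q = 2, size q = 3, size q = 4 | size q = 5]%N.
- move: (size q) (size r) sE sr0 sq0 sq1 => m n sE n0 m0 m1.
  have : (m == 2) || (m == 3) || (m == 4) || (m == 5) by lia.
  by case/orP => [/orP[/orP[]|]|] /eqP ->; [apply: Or41|apply: Or42|apply: Or43|apply: Or44].
- by move=> s2; case: (lin q s2 dq).
- move=> s3; case: (@noquad r q) => //; lia.
- by move=> s4; case: (lin r _ dr); lia.
- by move=> s5; rewrite -dvdp_size_eqp // s5 size_biquad_poly.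
Qed.

Lemma biquad_horner (L : fieldType) (f : {rmorphism K -> L}) th :
  (map_poly f biquad_poly).[th] =
    th ^+ 4 - 2%:R * (f a + f b) * th ^+ 2 + (f a - f b) ^+ 2.
Proof.
rewrite /biquad_poly !raddfD /=.
rewrite map_polyZ !map_polyXn map_polyC /= !(hornerD, hornerZ, hornerXn, hornerC).
by rewrite rmorphN rmorphM rmorph_nat rmorphD rmorphXn rmorphB addrA mulNr.
Qed.

End Biquadratic.

Lemma klein_onto (gT : finGroupType) (G : {group gT}) (f : gT -> bool * bool) :
  (forall g, g \in G) -> #|G| = 4%N -> injective f -> forall y, exists g, f g = y.
Proof.
move=> inG cG injf y.
have /codomP [g ->] : y \in codom f; last by exists g.
apply: inj_card_onto => //; rewrite card_prod card_bool.
by rewrite -(eq_card (A := G)) ?cG // => g; rewrite inG.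
Qed.

Lemma biquadratic_field (K : fieldType) (a b : K) : 2%:R != 0 :> K ->
    (forall x, x ^+ 2 != a) -> (forall x, x ^+ 2 != b) -> (forall x, x ^+ 2 != a * b) ->
  exists (L : splittingFieldType K) (A B : L),
    [/\ A ^+ 2 = a%:A, B ^+ 2 = b%:A, uniq [:: A; - A; B; - B],
        <<1 & [:: A; - A; B; - B]>>%VS = fullv & \dim {:L} = 4%N].
Proof.
move=> nz2 sqa sqb sqab.
have [L0 dimL [th rth genth]] := irredp_FAdjoin (biquad_irreducible nz2 sqa sqb sqab).
have nab : b - a != 0 by rewrite subr_eq0; apply: contraTneq (sqab a) => ->; rewrite expr2 eqxx.
have [i iE] : exists i : {rmorphism K -> L0}, forall y : K, y%:A = i y by exists (in_alg L0).
have nz2i : 2%:R != 0 :> L0 by rewrite -(rmorph_nat i) fmorph_eq0.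
have nabi : i b - i a != 0 by rewrite -rmorphB fmorph_eq0.
have thE : th ^+ 4 - 2%:R * (i a + i b) * th ^+ 2 + (i a - i b) ^+ 2 = 0.
  by move: rth; rewrite /root (eq_map_poly (g := i)) // biquad_horner => /eqP.
(* For th = A + B one has th^3 = (a + 3 b) A + (3 a + b) B; eliminating B gives this formula. *)
pose A := (th ^+ 3 - (3%:R * i a + i b) * th) / (2%:R * (i b - i a)).
pose B := th - A.
have A2 : A ^+ 2 = i a.
  apply/eqP; rewrite -subr_eq0; apply/eqP.
  transitivity ((th ^+ 4 - 2%:R * (i a + i b) * th ^+ 2 + (i a - i b) ^+ 2) * (th ^+ 2 - 4%:R * i a) / (2%:R * (i b - i a)) ^+ 2).
    by rewrite /A; field; rewrite nz2i nabi.
  by rewrite thE !mul0r.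
have B2 : B ^+ 2 = i b.
  apply/eqP; rewrite -subr_eq0; apply/eqP.
  transitivity ((th ^+ 4 - 2%:R * (i a + i b) * th ^+ 2 + (i a - i b) ^+ 2) * (th ^+ 2 - 4%:R * i b) / (2%:R * (i b - i a)) ^+ 2).
    by rewrite /B /A; field; rewrite nz2i nabi.
  by rewrite thE !mul0r.
have nzA : A != 0 by apply: contraTneq (sqa 0) => A0; rewrite expr0n /= eq_sym negbK -(fmorph_eq0 i) -A2 A0 expr0n.
have nzB : B != 0 by apply: contraTneq (sqb 0) => B0; rewrite expr0n /= eq_sym negbK -(fmorph_eq0 i) -B2 B0 expr0n.
pose rs := [:: A; - A; B; - B].
have neg x : x != 0 -> x != - x :> L0.
  by move=> nx; rewrite -subr_eq0 opprK -mulr2n -mulr_natl mulf_neq0.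
have nAB x y : x ^+ 2 = i a -> y ^+ 2 = i b -> x != y.
  by move=> xa yb; apply: contraNneq nabi => E; rewrite -xa -yb E subrr.
have Urs : uniq rs.
  have [nA nB] := conj (neg A nzA) (neg B nzB).
  have n1 := nAB _ _ A2 B2.
  have [n2 n3 n4] : [/\ A != - B, - A != B & - A != - B] by split; apply: nAB; rewrite ?sqrrN.
  by rewrite /= !inE !negb_or nA nB n1 n2 n3 n4.
pose P := \prod_(x <- rs) ('X - x%:P).
have PE : P = ('X^2 - (i a)%:P) * ('X^2 - (i b)%:P).
  rewrite /P !big_cons big_nil mulr1 -A2 -B2 !rmorphXn /= !rmorphN /=; ring.
have Pover : P \is a polyOver 1%VS.
  rewrite PE; apply: rpredM; apply: rpredB; rewrite ?polyOverXn // polyOverC.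
    by rewrite -iE rpredZ ?mem1v.
  by rewrite -iE rpredZ ?mem1v.
have gen : <<1 & rs>>%VS = fullv.
  apply/eqP; rewrite eqEsubv subvf -genth; apply/FadjoinP; split; first exact: subv_adjoin_seq.
  have -> : th = A + B by rewrite /B addrC subrK.
  by rewrite rpredD // seqv_sub_adjoin // !inE eqxx ?orbT.
have split : splittingFieldFor 1 P fullv by exists rs; rewrite ?eqpxx.
have axL : SplittingField.axiom L0 by exists P.
pose mL := FieldExt_isSplittingField.Build K L0 axL.
pose L : splittingFieldType K := HB.pack_for (splittingFieldType K) L0 mL.
exists L, A, B; split => //.
- by rewrite iE.
- by rewrite iE.
- by rewrite [LHS]dimL size_biquad_poly.
Qed.

Lemma biquad_split_poly (K : fieldType) (L : fieldExtType K) (a b : K) (A B : L) :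
    A ^+ 2 = a%:A -> B ^+ 2 = b%:A ->
  \prod_(x <- [:: A; - A; B; - B]) ('X - x%:P) \is a polyOver 1%VS.
Proof.
move=> A2 B2.
have -> : \prod_(x <- [:: A; - A; B; - B]) ('X - x%:P) = ('X^2 - (A ^+ 2)%:P) * ('X^2 - (B ^+ 2)%:P).
  by rewrite !big_cons big_nil mulr1 !rmorphXn /= !rmorphN /=; ring.
by rewrite A2 B2; apply: rpredM; apply: rpredB; rewrite ?polyOverXn // polyOverC rpredZ ?mem1v.
Qed.

(** An automorphism is determined by its signs at A and B, and there are four automorphisms, so
    every pair of signs occurs. *)
Lemma biquadratic_extension (K : fieldType) (a b : K) : 2%:R != 0 :> K ->
    (forall x, x ^+ 2 != a) -> (forall x, x ^+ 2 != b) -> (forall x, x ^+ 2 != a * b) ->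
  exists (L : splittingFieldType K) (s t : gal_of {:L}) (A B : L),
    [/\ galois_with_group L C2xC2,
        [/\ uniq [:: 1; s; t; s * t]%g, forall g, g \in [:: 1; s; t; s * t]%g,
            (s * s = 1)%g, (t * t = 1)%g & (s * t = t * s)%g],
        A ^+ 2 = a%:A /\ B ^+ 2 = b%:A, s A = - A /\ s B = B & t A = A /\ t B = - B].
Proof.
move=> nz2 sqa sqb sqab.
have [L [A [B [A2 B2 Urs gen dimL]]]] := biquadratic_field nz2 sqa sqb sqab.
have galL : galois 1%VS {:L}%VS.
  apply/splitting_galoisField; exists (\prod_(x <- [:: A; - A; B; - B]) ('X - x%:P)); split.
  - exact: biquad_split_poly A2 B2.
  - by rewrite separable_prod_XsubC.
  - by exists [:: A; - A; B; - B]; rewrite ?eqpxx.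
have cG : #|'Gal({:L} / 1)%g| = 4%N by rewrite -(galois_dim galL) dimv1 divn1 dimL.
have gi (g : gal_of {:L}) (y : K) : g y%:A = y%:A by rewrite linearZ /= rmorph1.
have gA (g : gal_of {:L}) : g A = A \/ g A = - A.
  have : (g A) ^+ 2 == A ^+ 2 by rewrite -rmorphXn /= A2 gi.
  by rewrite eqf_sqr => /orP[] /eqP ->; [left|right].
have gB (g : gal_of {:L}) : g B = B \/ g B = - B.
  have : (g B) ^+ 2 == B ^+ 2 by rewrite -rmorphXn /= B2 gi.
  by rewrite eqf_sqr => /orP[] /eqP ->; [left|right].
have eqAB (g h : gal_of {:L}) : g A = h A -> g B = h B -> g = h.
  move=> EA EB; pose k := (g * h^-1)%g.
  have hV x : (h^-1)%g (h x) = x by rewrite -galM ?memvf // mulgV gal_id.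
  have kA : k A = A by rewrite galM ?memvf // EA hV.
  have kB : k B = B by rewrite galM ?memvf // EB hV.
  have : (<<1 & [:: A; - A; B; - B]>> <= fixedField [set k])%VS.
    apply/Fadjoin_seqP; split; first exact: sub1v.
    move=> x; rewrite !inE => /or4P[] /eqP ->; rewrite ?rpredN;
      by apply/fixedFieldP; rewrite ?memvf // => ? /set1P ->.
  rewrite gen => /subvP fix_k; have : k = 1%g.
    apply/eqP/gal_eqP => x xL; rewrite gal_id.
    by have [_ ->] := mem_fixedFieldP (fix_k x xL); rewrite ?set11.
  by move/eqP; rewrite /k -eq_mulgV1 => /eqP.
pose f (g : gal_of {:L}) := (g A == A, g B == B).
have neqA : (- A == A) = false.
  by move: Urs; rewrite /= !inE !negb_or eq_sym => /and3P[/and3P[/negPf]].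
have neqB : (- B == B) = false.
  by move: Urs; rewrite /= !inE !negb_or [B == - B]eq_sym => /and4P[_ _ /negPf].
have injf : injective f.
  move=> g h [EA EB]; apply: eqAB.
    by move: EA; case: (gA g) => ->; case: (gA h) => ->; rewrite ?eqxx ?neqA.
  by move: EB; case: (gB g) => ->; case: (gB h) => ->; rewrite ?eqxx ?neqB.
have onto := klein_onto (@mem_gal1 K L) cG injf.
have val (g : gal_of {:L}) (x y : bool) : f g = (x, y) -> g A = (if x then A else - A) /\ g B = (if y then B else - B).
  move=> [<- <-]; case: (gA g) => ->; case: (gB g) => ->; by rewrite ?eqxx ?neqA ?neqB.
have [s /val [/= sA sB]] := onto (false, true).
have [t /val [/= tA tB]] := onto (true, false).
have stA : (s * t)%g A = - A by rewrite galM ?memvf // sA rmorphN /= tA.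
have stB : (s * t)%g B = - B by rewrite galM ?memvf // sB tB.
have U : uniq [:: 1; s; t; s * t]%g.
  rewrite -(map_inj_uniq injf) /= /f !gal_id sA sB tA tB stA stB !eqxx neqA neqB.
  by [].
have inU g : g \in [:: 1; s; t; s * t]%g.
  rewrite -(mem_map injf) /= /f !gal_id sA sB tA tB stA stB !eqxx neqA neqB.
  by case: (_ == _); case: (_ == _).
have [ss tt st] : [/\ s * s = 1, t * t = 1 & s * t = t * s]%g.
  split; apply: eqAB;
    by rewrite ?galM ?memvf // ?gal_id ?(sA, sB, tA, tB) ?rmorphN /= ?(sA, sB, tA, tB) ?opprK.
exists L, s, t, A, B; split => //; split => //.
exact: (klein_isog (@mem_gal1 K L) U inU).
Qed.

Lemma prodset_principal (K : fieldType) (V : lmodType K) (g : K) n (M : set V) :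
    g != 0 -> M 0 -> (forall x y, M x -> M y -> M (x + y)) ->
    (forall c x, ringint c -> M x -> M (c *: x)) -> forall x,
  prodset (fun (c : K) (v : V) => c *: v) (idealX (principal g) n) M x <->
  exists2 m, M m & x = g ^+ n *: m.
Proof.
move=> nzg M0 MD MZ x; rewrite idealX_principal; split.
  move=> [k [a [m [Ia Mm ->]]]].
  pose Q y := exists2 m, M m & y = g ^+ n *: m.
  apply: (big_ind Q); rewrite /Q.
  - by exists 0; rewrite ?scaler0.
  - by move=> _ _ [y My ->] [z Mz ->]; exists (y + z); rewrite ?scalerDr //; apply: MD.
  - by move=> l _; have [u Ou <-] := Ia l; exists (u *: m l); rewrite ?scalerA //; apply: MZ.
move=> [m Mm ->]; exists 1%N, (fun=> g ^+ n), (fun=> m); split => // [_|].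
  exact: principal_id.
by rewrite big_ord1.
Qed.

(** * Associated order and completions *)

Section AssociatedOrder.
Variables (K : fieldType) (L : splittingFieldType K).
Local Notation act := (@group_ring_act K L).
Local Notation A := (@assoc_order K L).
Local Notation O := (@ringint L).

Lemma group_ring_actD a b y : act (a + b) y = act a y + act b y.
Proof.
rewrite /group_ring_act -big_split; apply: eq_bigr => s _.
by rewrite ffunE scalerDl.
Qed.

Lemma group_ring_actZ c a y : act (c *: a) y = c *: act a y.
Proof.
rewrite /group_ring_act scaler_sumr; apply: eq_bigr => s _.
by rewrite ffunE scalerA.
Qed.

Lemma group_ring_act0 y : act 0 y = 0.
Proof. by rewrite -(scale0r 0) group_ring_actZ scale0r. Qed.

Lemma group_ring_actN a y : act (- a) y = - act a y.
Proof. by rewrite -scaleN1r group_ring_actZ scaleN1r. Qed.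

Lemma group_ring_actDr a x y : act a (x + y) = act a x + act a y.
Proof.
rewrite /group_ring_act -big_split; apply: eq_bigr => s _.
by rewrite rmorphD scalerDr.
Qed.

Lemma group_ring_actZr a c y : act a (c *: y) = c *: act a y.
Proof.
rewrite /group_ring_act scaler_sumr; apply: eq_bigr => s _.
by rewrite linearZ /= !scalerA mulrC.
Qed.

Lemma group_ring_actBr a x y : act a (x - y) = act a x - act a y.
Proof. by rewrite group_ring_actDr -[- y]scaleN1r group_ring_actZr scaleN1r. Qed.

Lemma ringintZ (c : K) (x : L) : ringint c -> O x -> O (c *: x).
Proof.
move=> Oc Ox; rewrite -(mul1r x) scalerAl; apply: ringintM => //.
exact/ringint_alg.
Qed.

Lemma assoc_order0 : A 0.
Proof. by move=> y Oy; rewrite group_ring_act0. Qed.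
Lemma assoc_orderD a b : A a -> A b -> A (a + b).
Proof. by move=> Aa Ab y Oy; rewrite group_ring_actD; apply: ringintD; [apply: Aa | apply: Ab]. Qed.
Lemma assoc_orderZ c a : ringint c -> A a -> A (c *: a).
Proof. by move=> Oc Aa y Oy; rewrite group_ring_actZ; apply: ringintZ => //; apply: Aa. Qed.

(** Let b represent the first basis vector. If c sends it into g O, then c b = g times a combination
    of the basis with coefficients a_i, and independence puts c - g a_0 into g A. Hence c is in g A
    and sends all of O into g O. *)
Lemma completion_free_generator (g : K) : g != 0 -> ringint g -> ~ ringint g^-1 ->
    completion_free_over act (principal g) A O ->
  exists2 b, O b & forall c, A c -> O (g^-1 *: act c b) -> forall x, O x -> O (g^-1 *: act c x).
Proof.
move=> nzg Og nOg [n [b [cohb span inj]]].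
have PA := prodset_principal (M := A) _ nzg assoc_order0 assoc_orderD assoc_orderZ.
have PO := prodset_principal (M := O) _ nzg (ringint0 L) (@ringintD L) ringintZ.
have coh_const (x : L) : O x -> coherent (principal g) O (fun=> x).
  move=> Ox k; split => //; apply/PO; exists 0; rewrite ?scaler0 ?subrr //.
(* An empty basis would put 1 into g O, against the non-integrality of 1 / g. *)
case: n b cohb span inj => [|n] b cohb span inj.
  have [a [_ /(_ 1%N)]] := span _ (coh_const 1 (ringint1 L)).
  rewrite big_ord0 => /PO [m Om]; rewrite expr1 => E; case: nOg.
  apply/(ringint_alg L); suff -> : (g^-1)%:A = m by [].
  by have := congr1 (fun v => g^-1 *: v) E; rewrite scalerA mulVf // scale1r subr0.
pose B := b ord0.
have OB k : O (B k) by case: (cohb ord0 k).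
have dB k : exists2 m, O m & B k.+1 - B k = g ^+ k *: m by case: (cohb ord0 k) => _ /PO.
exists (B 1%N) => // c Ac Oc1.
have Oc k : O (g^-1 *: act c (B k.+1)).
  elim: k => [//|k IH]; have [m Om E] := dB k.+1.
  rewrite -(subrK (B k.+1) (B k.+2)) E group_ring_actDr scalerDr; apply: ringintD => //.
  rewrite group_ring_actZr scalerA exprS mulrA mulVf // mul1r.
  by apply: ringintZ; [apply: ringintX | apply: Ac].
(* The shift is needed because [B 0] is unconstrained: [B 1] is the first term whose class modulo g
   belongs to the limit. *)
pose y k := g^-1 *: act c (B k.+1).
have cohy : coherent (principal g) O y.
  move=> k; split; first exact: Oc.
  apply/PO; have [m Om E] := dB k.+1; exists (act c m); first exact: Ac.
  by rewrite /y -scalerBr -group_ring_actBr E group_ring_actZr scalerA exprS mulrA mulVf // mul1r.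
have [a [coha nully]] := span y cohy.
pose a' (i : 'I_n.+1) : nat -> group_ring L :=
  fun k => (if i == ord0 then c else 0) - g *: a i k.
have Aa i k : A (a i k) by case: (coha i k).
have Ag x : A x -> A (- (g *: x)).
  by move=> Ax; rewrite -scaleNr; apply: assoc_orderZ => //; apply: ringintN.
have coha' i : coherent (principal g) A (a' i).
  move=> k; split.
    by apply: assoc_orderD; [case: ifP => // _; apply: assoc_order0 | apply: Ag].
  apply/PA; have [_ /PA [m Am E]] := coha i k; exists (- (g *: m)); first exact: Ag.
  rewrite /a' opprD opprK addrACA subrr add0r addrC -scalerBr -opprB E.
  by rewrite !scalerN !scalerA mulrC.
have nulla' : null_seq (principal g) O (\sum_i (fun k => act (a' i k) (b i k))).
  move=> k; apply/PO; rewrite fct_sumE.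
  have /PO [m Om E] := nully k; have [m' Om' E'] := dB k.
  have -> : \sum_i act (a' i k) (b i k) = act c (B k) - g *: \sum_i act (a i k) (b i k).
    rewrite (bigD1 ord0) //= [in RHS](bigD1 ord0) //= scalerDr opprD addrA.
    rewrite {1}/a' eqxx group_ring_actD group_ring_actN group_ring_actZ; congr (_ + _).
    rewrite scaler_sumr -sumrN; apply: eq_bigr => i /negPf ni.
    by rewrite /a' ni add0r group_ring_actN group_ring_actZ.
  have -> : \sum_i act (a i k) (b i k) = y k - g ^+ k *: m.
    by rewrite -E !fctE fct_sumE subKr.
  exists (g *: m - act c m').
    by apply: ringintB; [apply: ringintZ | apply: Ac].
  rewrite scalerBr /y scalerA divff // scale1r opprB addrCA.
  have -> : act c (B k) - act c (B k.+1) = - act c (B k.+1 - B k).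
    by rewrite group_ring_actBr opprB.
  by rewrite E' group_ring_actZr scalerBr !scalerA [g * _]mulrC.
(* The null sequence is read at level 1: c - g a_0 is g times an element d of the order. *)
have /PA [d Ad] := inj a' coha' nulla' ord0 1%N.
rewrite /a' eqxx expr1 => E x Ox.
have -> : c = g *: (d + a ord0 1%N) by rewrite scalerDr -E subrK.
rewrite group_ring_actZ scalerA mulVf // scale1r.
by apply: assoc_orderD.
Qed.

End AssociatedOrder.

(** By Bezout the denominator of x is a unit of O_K, and an odd numerator in p would put 1 into p.
    So a prime above 2 meets the rational integers in multiples of 2. *)
Lemma rat_ringint_below (K : fieldExtType rat) (p : set K) (x : rat) :
    prime_ideal p -> p 2%:R -> ringint x -> p x%:A ->
  exists2 y : K, ringint y & x%:A = 2%:R * y.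
Proof.
move=> pp p2 Ox px.
have dN0 : denq x != 0 := denq_neq0 x.
have Ox' : ringint (x%:A : K) by apply/ringint_alg.
have xd : x * (denq x)%:~R = (numq x)%:~R.
  by rewrite -{1}(divq_num_den x) divfK // intr_eq0.
have cop := coprime_num_den x.
have /coprimezP [[u v] /= uv] : coprimez (numq x) (denq x) by rewrite coprimezE.
have iE (n : int) : (n%:~R : rat)%:A = n%:~R :> K by rewrite scaler_int.
pose D : K := (denq x)%:~R.
have nzD : D != 0 by rewrite numfield_intr_eq0.
have xD : x%:A * D = (numq x)%:~R :> K.
  by rewrite /D -iE -scalerAl mul1r scalerA xd iE.
have OD : ringint D^-1.
  have -> : D^-1 = u%:~R * x%:A + v%:~R.
    apply: (mulIf nzD); rewrite mulVf // mulrDl -mulrA xD /D -!intrM -intrD uv.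
    by [].
  by apply: ringintD; [apply: ringintM => // |]; apply: ringint_int.
have pn : p (numq x)%:~R by rewrite -xD; apply: primeMr => //; apply: ringint_int.
have [n nE] : exists n : int, numq x = n * 2.
  have := divz_eq (numq x) 2; set q := (_ %/ _)%Z.
  have : (0 <= (numq x %% 2)%Z < 2) by rewrite modz_ge0 //= ltz_pmod.
  case: (numq x %% 2)%Z => [[|[|//]]|//] _ E; first by exists q; rewrite E addr0.
  exfalso; apply: (prime_n1 pp); move: pn; rewrite E intrD intrM => pn.
  rewrite -[1](addKr (q%:~R * 2%:~R)) addrC; apply: primeB => //.
  by apply: primeMl => //; apply: ringint_int.
exists (n%:~R * D^-1); first by apply: ringintM => //; apply: ringint_int.
by apply: (mulIf nzD); rewrite xD nE intrM -!mulrA mulVf // mulr1 mulrC.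
Qed.

Lemma klein_span (K L : fieldType) (i : {rmorphism K -> L}) (S T : {rmorphism L -> L}) (A B : L) :
    involutive S -> involutive T -> (forall x, S (T x) = T (S x)) ->
    (forall x, S x = x -> T x = x -> exists y, x = i y) ->
    S A = - A -> S B = B -> T A = A -> T B = - B ->
    A != 0 -> B != 0 -> 4%:R != 0 :> L ->
  forall x, exists y0 y1 y2 y3 : K, x = i y0 + i y1 * A + i y2 * B + i y3 * (A * B).
Proof.
move=> SK TK ST fixK SAE SBE TAE TBE nzA nzB n4 x.
have [y0 E0] : exists y, x + S x + T x + S (T x) = i y.
  by apply: fixK; rewrite !rmorphD /=; [rewrite !SK | rewrite -!ST !TK]; ring.
have [y1 E1] : exists y, (x - S x + T x - S (T x)) / A = i y.
  apply: fixK; rewrite fmorph_div !rmorphD !rmorphN /=.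
    by rewrite !SK SAE invrN; ring.
  by rewrite -!ST !TK TAE; ring.
have [y2 E2] : exists y, (x + S x - T x - S (T x)) / B = i y.
  apply: fixK; rewrite fmorph_div !rmorphD !rmorphN /=.
    by rewrite !SK SBE; ring.
  by rewrite -!ST !TK TBE invrN; ring.
have [y3 E3] : exists y, (x - S x - T x + S (T x)) / (A * B) = i y.
  apply: fixK; rewrite fmorph_div rmorphM !rmorphD !rmorphN /=.
    by rewrite !SK SAE SBE mulNr invrN; ring.
  by rewrite -!ST !TK TAE TBE mulrN invrN; ring.
exists (y0 / 4%:R), (y1 / 4%:R), (y2 / 4%:R), (y3 / 4%:R).
rewrite !fmorph_div !rmorph_nat -E0 -E1 -E2 -E3.
by field; rewrite n4 nzA nzB.
Qed.

(** * The wild extension of K and its associated order *)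

Section WildExtension.
Variables (K : fieldExtType rat) (pi w : K) (j : nat).
Local Notation OK := (@ringint K).
Local Notation p := (principal pi).
Hypotheses (nzpi : pi != 0) (primep : prime_ideal p) (Ow : OK w) (npw : ~ p w).
Hypothesis two_pi : 2%:R = pi ^+ (j + 2) * w.

Let Opi : OK pi. Proof. by apply: (prime_int primep); apply: principal_id. Qed.
Let ppi : p pi. Proof. exact: principal_id. Qed.
Let a := 1 + pi ^+ (2 * j).+1.
Let p_a : ~ p a.
Proof.
move=> pa; apply: (prime_n1 primep); rewrite -(addrK (pi ^+ (2 * j).+1) 1).
by apply: primeB => //; rewrite exprS; apply: primeMr; auto.
Qed.
Let Oa : OK a. Proof. by rewrite /a; auto. Qed.

(** The valuation of c pi at p is 1, hence odd. *)
Let nonsquare_pi_mul c x : OK c -> ~ p c -> x ^+ 2 != c * pi.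
Proof.
move=> Oc npc; apply/eqP => E.
have Ox : OK x by apply: ringint_sqr; rewrite E; auto.
have [t Ot xE] : p x by apply: (prime_X primep (n := 2)) => //; rewrite E; apply: primeMl.
apply: npc; have -> : c = pi * t ^+ 2.
  by apply: (mulIf nzpi); rewrite -E -xE; ring.
by apply: primeMr; auto.
Qed.

(** A square root x would make (x - 1) / pi^j a root in K of the Eisenstein polynomial X^2 + pi^2 w
    X - pi. *)
Let nonsquare_a x : x ^+ 2 != a.
Proof.
apply/eqP => E; pose q := pi ^+ j; have nzq : q != 0 by rewrite expf_neq0.
pose al := (x - 1) / q.
have xE : x = 1 + q * al by rewrite /al mulrC divfK // addrC subrK.
have al2 : al ^+ 2 + pi ^+ 2 * w * al + - pi = 0.
  apply: (mulfI (expf_neq0 2 nzq)); rewrite mulr0.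
  have -> : q ^+ 2 * (al ^+ 2 + pi ^+ 2 * w * al + - pi) =
     (1 + q * al) ^+ 2 - (1 + q ^+ 2 * pi) - (2%:R - q * pi ^+ 2 * w) * (q * al) by ring.
  have aE : a = 1 + q ^+ 2 * pi by rewrite /a /q exprS -exprM mulnC mulrC.
  have twoE : 2%:R = q * pi ^+ 2 * w by rewrite two_pi exprD.
  by rewrite -xE E aE twoE; ring.
have Oal : OK al by apply: ringint_quadratic al2; auto.
have al2' : al ^+ 2 = pi * (1 - pi * w * al).
  by rewrite -[RHS](add0r) -al2; ring.
have [t Ot tE] : p al.
  by apply: (prime_X primep (n := 2)) => //; rewrite al2'; apply: primeMr; auto.
apply: (prime_n1 primep); have -> : 1 = pi * (t ^+ 2 + pi * w * t).
  apply: (mulfI nzpi); rewrite mulr1; apply/eqP; rewrite -subr_eq0; apply/eqP.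
  by rewrite -[RHS]oppr0 -al2 -tE; ring.
by apply: primeMr; auto.
Qed.

Lemma wild_klein_extension : exists L : splittingFieldType K,
  galois_with_group L C2xC2 /\ ~ locally_free_over_assoc_order L.
Proof.
have nz2 : 2%:R != 0 :> K by apply: numfield_nat_neq0.
have sqpi x : x ^+ 2 != pi.
  by rewrite -[pi]mul1r; apply: nonsquare_pi_mul => //; apply: prime_n1.
have sqapi x : x ^+ 2 != a * pi by apply: nonsquare_pi_mul.
have [L [s [t [A [B [[galL isoL] [U inU ss tt st] [A2 B2] [sA sB] [tA tB]]]]]]] :=
  biquadratic_extension nz2 nonsquare_a sqpi sqapi.
exists L; split; first by split.
move=> /(_ _ primep) free.
pose S : {rmorphism L -> L} := s; pose T : {rmorphism L -> L} := t.
have [i iE] : exists i : {rmorphism K -> L}, forall y : K, y%:A = i y by exists (in_alg L).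
have SA y : S (i y) = i y by rewrite -iE -[LHS]/(s y%:A) linearZ /= rmorph1.
have TA y : T (i y) = i y by rewrite -iE -[LHS]/(t y%:A) linearZ /= rmorph1.
have SK : involutive S.
  move=> x.
  by have := galM s s (memvf x); rewrite ss gal_id => E; exact: esym E.
have TK : involutive T.
  move=> x.
  by have := galM t t (memvf x); rewrite tt gal_id => E; exact: esym E.
have ST x : S (T x) = T (S x).
  by have := galM s t (memvf x); rewrite st galM ?memvf // => E; exact: E.
have fixK x : S x = x -> T x = x -> exists y : K, x = i y.
  by move=> Sx Tx; have [y ->] := klein_fixed inU galL Sx Tx; exists y; rewrite -iE.
have nzA : A != 0.
  by apply: contraTneq (nonsquare_a 0) => A0; rewrite expr0n negbK eq_sym -(fmorph_eq0 i) -iE -A2 A0 expr0n.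
have nzB : B != 0.
  by apply: contraTneq (sqpi 0) => B0; rewrite expr0n negbK eq_sym -(fmorph_eq0 i) -iE -B2 B0 expr0n.
have n4 : 4%:R != 0 :> L by case: (ext_finite_quotients L (m := 4) isT).
have SAE : S A = - A by []; have SBE : S B = B by [].
have TAE : T A = A by []; have TBE : T B = - B by [].
have spanL x : exists y0 y1 y2 y3 : K, x = i y0 + i y1 * A + i y2 * B + i y3 * (A * B).
  exact: (klein_span SK TK ST fixK SAE SBE TAE TBE nzA nzB n4).
have nOpi : ~ OK pi^-1.
  by move=> H; apply: (prime_n1 primep); apply/principalP => //; rewrite div1r.
have [b Ob H] := completion_free_generator nzpi Opi nOpi free.
have [[n1 n2 n3] [m1 m2 m3]] := klein_neq U.
have [ct ctE] : exists c, c = pi ^- j.+1 by exists (pi ^- j.+1).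
have [cu cuE] : exists c, c = pi ^- (j + 3) by exists (pi ^- (j + 3)).
pose te : group_ring L := [ffun g => if g == 1%g then - ct else if g == t then ct else 0].
pose ue : group_ring L := [ffun g => if g == 1%g then cu else if g == s then - cu else if g == t then - cu else cu].
have teE x : group_ring_act te x = wild_t i T pi j x.
  rewrite (klein_act U inU) !ffunE !eqxx (negPf n1) (negPf n2) (negPf n3) (eq_sym s) (negPf m1) (negPf m3).
  rewrite -![in_alg L _]/(_%:A) !iE !rmorphN rmorph0 ctE fmorphV rmorphXn /wild_t.
  rewrite -[t x]/(T x); ring.
have ueE x : group_ring_act ue x = wild_u i S T pi j x.
  rewrite (klein_act U inU) !ffunE !eqxx (negPf n1) (negPf n2) (negPf n3) (negPf m1) (negPf m2) (negPf m3).
  rewrite -![in_alg L _]/(_%:A) !iE !rmorphN cuE fmorphV rmorphXn /wild_u.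
  rewrite -[t (s x)]/(T (S x)) -[t x]/(T x) -[s x]/(S x); ring.
have A2' : A ^+ 2 = i (1 + pi ^+ (2 * j).+1) by rewrite A2 iE.
have B2' : B ^+ 2 = i pi by rewrite B2 iE.
apply: (wild_not_free nzpi primep Ow npw two_pi SA TA A2' B2' SAE SBE TAE TBE spanL Ob).
move=> c1 c2 Oc1 Oc2.
have actE x : (i c1 * wild_t i T pi j x + i c2 * wild_u i S T pi j x) / i pi
   = pi^-1 *: group_ring_act (c1 *: te + c2 *: ue) x.
  rewrite group_ring_actD !group_ring_actZ teE ueE.
  have iZ (c : K) (v : L) : c *: v = i c * v by rewrite -iE -scalerAl mul1r.
  by rewrite !iZ fmorphV; ring.
move=> Hb x Ox; rewrite actE; apply: H => //; last by rewrite -actE.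
apply: assoc_orderD; apply: assoc_orderZ => // y Oy.
- rewrite teE; exact: (wild_t_int nzpi primep Ow npw two_pi SA TA A2' B2' SAE TAE TBE spanL Oy).
- rewrite ueE; exact: (wild_u_int nzpi primep Ow npw two_pi SA TA A2' B2' SAE SBE TAE TBE spanL Oy).
Qed.

End WildExtension.

Theorem theorem1p6 (K : fieldExtType rat)
  (ray_trivial : ray_class_group_trivial (principal (4%:R : K)))
  (ram_above_2 : exists (p : set K) (e : nat),
     [/\ prime_ideal p, p 2%:R, ram_index p e & (3 <= e)%N]) :
  hilbert_speiser K C2xC2 /\
  exists L : splittingFieldType K,
    galois_with_group L C2xC2 /\ ~ locally_free_over_assoc_order L.
Proof.
split; first exact: tame_klein_normal_basis.
have [p [e [pp p2 [ram_in ram_nin] e3]]] := ram_above_2.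
have [idp nzp _ _] := pp.
have [pi nzpi pE] := ideal_principal ray_trivial idp nzp.
have two_below : ideal_ext (prime_below p) (2%:R : K).
  exists 1%N, (fun=> 2%:R), (fun=> 1); split => // [_|].
    by split; [exact: ringint_nat | rewrite scaler_nat].
  by rewrite big_ord1 scaler_nat.
have [w Ow wE] : principal (pi ^+ e) 2%:R.
  by rewrite -idealX_principal -pE; apply: ram_in.
(* If pi divided w, then 2 and with it everything below p would lie in p^(e + 1), against the
   ramification index. *)
have npw : ~ principal pi w.
  move=> [v Ov vE]; apply: ram_nin; rewrite pE idealX_principal.
  have Oie : ringint (pi ^+ e.+1).
    by apply: ringintX; apply: (prime_int pp); rewrite pE; apply: principal_id.
  have [[I0 ID IM] _] := ideal_principal_int Oie.
  move=> _ [n [a [m [pa Om ->]]]]; apply: big_ind => // k _.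
  have [Oa pak] : prime_below p (a k) by rewrite pE.
  have [y Oy yE] := rat_ringint_below pp p2 Oa pak.
  exists (v * (y * m k)).
    by apply: ringintM => //; apply: ringintM => //; apply: Om.
  rewrite -[m k in RHS]mul1r scalerAl yE -wE -vE exprSr; ring.
apply: (@wild_klein_extension K pi w (e - 2)) => //; first by rewrite -pE.
by rewrite subnK // ltnW.
Qed.
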